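(* Let $q\equiv1\pmod{24}$ be a prime power, let $\eta\in\widehat{\mathbb F_q^\times}$ have order $24$, and let $x\in\mathbb F_q$ with $x\neq-\tfrac18,\tfrac14$. Then $${}_2\mathbb F_1\!\left[\begin{matrix}\overline\eta&\eta^7\\&\eta^{18}\end{matrix};\frac{-27x}{(1-4x)^3}\right]=\frac{1+\phi(1-x)}2\left(\eta^3\!\left(\frac{(1+\sqrt{1-x})^2}{4(1-4x)}\right)+\eta^3\!\left(\frac{(1-\sqrt{1-x})^2}{4(1-4x)}\right)\right).$$
   Context: $\mathbb F_q$ is a finite field with $q$ elements, $q$ a power of an odd prime $p$. $\widehat{\mathbb F_q^\times}$ is the group of multiplicative characters $\chi:\mathbb F_q^\times\to\mathbb C^\times$; every character, including the trivial character $\varepsilon$, is extended to $\mathbb F_q$ by $\chi(0)=0$. $\phi$ is the quadratic character, $\overline\chi$ denotes the complex-conjugate (inverse) character, and products/powers of characters are pointwise. Jacobi sum: $J(A,B)=\sum_{x\in\mathbb F_q}A(x)B(1-x)$. Period function: ${}_2\mathbb P_1\!\left[\begin{matrix}A&B\\&C\end{matrix};\lambda\right]=\sum_{y\in\mathbb F_q}B(y)\,\overline BC(1-y)\,\overline A(1-\lambda y)$; normalized function ${}_2\mathbb F_1\!\left[\begin{matrix}A&B\\&C\end{matrix};\lambda\right]=\frac{1}{J(B,C\overline B)}\,{}_2\mathbb P_1\!\left[\begin{matrix}A&B\\&C\end{matrix};\lambda\right]$. For $w\in\mathbb F_q$, $\sqrt w$ denotes either square root of $w$ in $\mathbb F_q$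 when one exists (the expressions do not depend on the choice); when $w$ is a nonzero non-square the prefactor $(1+\phi(w))/2$ is $0$ and the whole right-hand side is interpreted as $0$. *)

(* Defs.v *)
From HB Require Import structures.
From mathcomp Require Import all_boot all_order all_algebra all_field.
Set Implicit Arguments. Unset Strict Implicit. Unset Printing Implicit Defensive.
Import Order.TTheory GRing.Theory Num.Theory.
Local Open Scope ring_scope.

Definition is_mchar (F : finFieldType) (chi : F -> algC) : Prop :=
  [/\ chi 0 = 0, chi 1 = 1 &
      forall x y : F, x != 0 -> y != 0 -> chi (x * y) = chi x * chi y].

(* pointwise power chi^n (n >= 1 in all uses), pointwise product, conjugate *)
Definition mchar_pow (F : finFieldType) (chi : F -> algC) (n : nat) : F -> algC :=
  fun x => chi x ^+ n.
Definition mchar_mul (F : finFieldType) (A B : F -> algC) : F -> algC :=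
  fun x => A x * B x.
Definition mchar_conj (F : finFieldType) (chi : F -> algC) : F -> algC :=
  fun x => (chi x)^*.

Definition mchar_order (F : finFieldType) (chi : F -> algC) (n : nat) : Prop :=
  [/\ (0 < n)%N,
      forall x : F, x != 0 -> chi x ^+ n = 1 &
      forall m : nat, (0 < m < n)%N -> exists2 x : F, x != 0 & chi x ^+ m != 1].

Definition qchar (F : finFieldType) (x : F) : algC :=
  if x == 0 then 0 else if [exists y : F, y * y == x] then 1 else -1.

Definition jacobi (F : finFieldType) (A B : F -> algC) : algC :=
  \sum_(x : F) A x * B (1 - x).

Definition period21 (F : finFieldType) (A B C : F -> algC) (lam : F) : algC :=
  \sum_(y : F) B y * mchar_mul (mchar_conj B) C (1 - y) * mchar_conj A (1 - lam * y).

Definition hyp21 (F : finFieldType) (A B C : F -> algC) (lam : F) : algC :=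
  period21 A B C lam / jacobi B (mchar_mul (mchar_conj B) C).

(* Main.v *)
Require Import Defs.
From HB Require Import structures.
From mathcomp Require Import all_boot all_order all_fingroup all_algebra.
From mathcomp Require Import all_solvable all_field all_character.
From mathcomp Require Import ring.
Set Implicit Arguments. Unset Strict Implicit. Unset Printing Implicit Defensive.
Import Order.TTheory GRing.Theory Num.Theory.
Local Open Scope ring_scope.

(** Write [rho = eta ^ 3], [q = #|F|] and [X = 4 x].

    The Mellin transform in [l] of the period function
      [f l = \sum_y eta ^ 7 (y) eta ^ 11 (1 - y) eta (1 - l y)]
    is a product of Gauss sums, and the Hasse-Davenport relations for 2 and 3 turn it,
    up to one character, into that of the double sum
      [T k = \sum_(w, m) rho (m) rho ^ 3 (1 + 2 w - m k) rho ^ -3 (1 + m w ^ 2)],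
    [k = - l / 27], in which only powers of [rho] occur. On the pullback
    [k = x / (1 - X) ^ 3] rational substitutions, whose exceptional fibre balances
    exactly when [x <> -1/8], bring [T k] to a sum over [z] of
    [rho ^ 2 (z) H ((z - 1) ^ 2 / z, X)], where [H (D, X) =
    \sum_i rho (i) rho ^ 3 (D - i) rho ^ -3 (i + X)]. The Mellin transform of this
    sum in [X] is, by Hasse-Davenport for 2, [q] times the one of
      [rho ^ -2 (X) \sum_(U | 16 U (1 - U) = X) rho ^ 2 (U)],
    except at two characters. The exceptional terms cancel and the roots
    [U = (1 +- sqrt (1 - x)) / 2] give the right-hand side. *)

(** * Reindexing of finite sums *)

Lemma sum_shift (V : nmodType) (A : finZmodType) (a : A) (f : A -> V) :
  \sum_x f (x + a) = \sum_x f x.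
Proof. by rewrite [RHS](reindex_inj (addIr a)). Qed.

Lemma sum_reflect (V : nmodType) (A : finZmodType) (a : A) (f : A -> V) :
  \sum_x f (a - x) = \sum_x f x.
Proof. by rewrite [RHS](reindex_inj (subrI a)). Qed.

Lemma sum_dilate (V : nmodType) (F : finFieldType) (a : F) (f : F -> V) :
  a != 0 -> \sum_x f (a * x) = \sum_x f x.
Proof. by move=> a0; rewrite [RHS](reindex_inj (mulfI a0)). Qed.

(* [ch c], for [c] in the index ring [R], runs over the group of multiplicative
   characters (extended by 0), written additively in [c]; [gam] generates the
   multiplicative group of [F]. *)
Record char_family (F : finFieldType) (R : finComNzRingType)
    (ch : R -> F -> algC) (gam : F) : Prop := CharFamily {
  cf_zero : forall c, ch c 0 = 0;
  cf_M : forall c x y, ch c (x * y) = ch c x * ch c y;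
  cf_D : forall c d x, ch (c + d) x = ch c x * ch d x;
  cf_0 : forall x, x != 0 -> ch 0 x = 1;
  cf_gam : gam != 0;
  cf_gen : forall x, x != 0 -> exists i, x = gam ^+ i;
  cf_inj : forall c, ch c gam = 1 -> c = 0;
  cf_sep : forall x, x != 0 -> x != 1 -> exists c, ch c x != 1 }.

(** * Multiplicative characters: values, orthogonality, Mellin inversion *)

Section CharacterSums.
Variables (F : finFieldType) (R : finComNzRingType).
Variables (ch : R -> F -> algC) (gam : F) (psi : F -> algC).
Hypothesis chF : char_family ch gam.
Hypothesis psiD : forall x y, psi (x + y) = psi x * psi y.
Hypothesis psi0 : psi 0 = 1.
Hypothesis psi_nontriv : exists x, psi x != 1.

Implicit Types (a b c d : R) (x y : F).

Let q : algC := #|F|%:R.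
Let J a b := jacobi (ch a) (ch b).
Let g c : algC := \sum_x ch c x * psi x.
Let sg c : algC := ch c (-1).
(** The squared absolute value of the Gauss sum [g c], see [gauss_norm]. *)
Let Nm (c : R) : algC := if c == 0 then 1 else q.

Let chz c : ch c 0 = 0. Proof. exact: cf_zero chF c. Qed.
Let chM c x y : ch c (x * y) = ch c x * ch c y. Proof. exact: cf_M chF c x y. Qed.
Let chD c d x : ch (c + d) x = ch c x * ch d x. Proof. exact: cf_D chF c d x. Qed.
Let ch0 x : x != 0 -> ch 0 x = 1. Proof. exact: cf_0 chF x. Qed.

Lemma card_neq0 : q != 0.
Proof. by rewrite pnatr_eq0 -lt0n; apply/card_gt0P; exists 0. Qed.
Let q0 := card_neq0.

Lemma chVK c x : x != 0 -> ch c x * ch (- c) x = 1.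
Proof. by move=> x0; rewrite -chD subrr ch0. Qed.

Lemma ch_neq0 c x : x != 0 -> ch c x != 0.
Proof.
move=> x0; apply/eqP=> cx; have := chVK c x0; rewrite cx mul0r => /eqP.
by rewrite eq_sym oner_eq0.
Qed.

Lemma ch1 c : ch c 1 = 1.
Proof.
have n0 := ch_neq0 c (oner_neq0 F); apply: (mulfI n0).
by rewrite -chM !mulr1.
Qed.

Lemma chV c x : ch c x^-1 = ch (- c) x.
Proof.
case: (eqVneq x 0) => [->|x0]; first by rewrite invr0 !chz.
apply: (mulfI (ch_neq0 c x0)); by rewrite -chM divff // ch1 chVK.
Qed.

Lemma chX c x n : ch c (x ^+ n) = ch c x ^+ n.
Proof. by elim: n => [|n IH]; rewrite ?ch1 // !exprS chM IH. Qed.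

Lemma ch_mulr n c x : x != 0 -> ch (n%:R * c) x = ch c x ^+ n.
Proof.
move=> x0; elim: n => [|n IH]; first by rewrite mul0r ch0.
by rewrite -addn1 natrD mulrDl mul1r chD IH addn1 exprSr.
Qed.

Lemma ch_mul2 c x : ch (2 * c) x = ch c (x ^+ 2).
Proof.
case: (eqVneq x 0) => [->|x0]; first by rewrite expr0n !chz.
by rewrite ch_mulr // chX.
Qed.

Lemma sgD c d : sg (c + d) = sg c * sg d. Proof. exact: chD. Qed.

Lemma sg2 c : sg (2 * c) = 1.
Proof. by rewrite /sg ch_mul2 sqrrN expr1n ch1. Qed.

Lemma sgK c : sg c * sg c = 1.
Proof. by rewrite -sgD -[c]mul1r -mulrDl sg2. Qed.

Lemma sgN c : sg (- c) = sg c.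
Proof.
have N1 : -1 != 0 :> F by rewrite oppr_eq0 oner_eq0.
by apply: (mulfI (ch_neq0 c N1)); rewrite [LHS]chVK // -[RHS]/(sg c * sg c) sgK.
Qed.

Lemma chN c x : ch c (- x) = sg c * ch c x.
Proof. by rewrite -mulN1r chM. Qed.

Lemma sum_ch c : \sum_x ch c x = if c == 0 then q - 1 else 0.
Proof.
case: eqVneq => [->|c0].
  rewrite (bigD1 0) //= chz add0r (eq_bigr (fun=> 1)) => [|x x0]; last exact: ch0.
  rewrite sumr_const cardC1 /q -subn1 natrB //.
  by apply/card_gt0P; exists 0.
have ck : ch c gam != 1 by apply: contra_neq c0; apply: cf_inj.
apply: (mulfI (_ : ch c gam - 1 != 0)); first by rewrite subr_eq0.
rewrite mulr0 mulrBl mul1r mulr_sumr.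
under eq_bigr do rewrite -chM.
by rewrite (sum_dilate (ch c) (cf_gam chF)) subrr.
Qed.

Lemma sum_ch_dual x : \sum_c ch c x = if x == 1 then #|R|%:R else 0.
Proof.
case: eqVneq => [->|x1].
  by rewrite (eq_bigr (fun=> 1)) => [|c _]; rewrite ?ch1 // sumr_const.
case: (eqVneq x 0) => [->|x0]; first by rewrite big1.
case: (cf_sep chF x0 x1) => d dx.
apply: (mulfI (_ : ch d x - 1 != 0)); first by rewrite subr_eq0.
rewrite mulr0 mulrBl mul1r mulr_sumr.
under eq_bigr do rewrite -chD addrC.
by rewrite (sum_shift d (fun c => ch c x)) subrr.
Qed.

(** Pairing the transform with the inverse characters recovers, by orthogonality, [#|R|] times the
    value at [x]. The value at 0 is lost, since every character vanishes there. *)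
Lemma mellin_inj (u v : F -> algC) :
  (forall c, \sum_x ch c x * u x = \sum_x ch c x * v x) ->
  forall x, x != 0 -> u x = v x.
Proof.
move=> uv x x0.
have inv w : \sum_c ch (- c) x * (\sum_y ch c y * w y) = #|R|%:R * w x.
  under eq_bigr do rewrite mulr_sumr.
  rewrite exchange_big (bigD1 x) //= [X in _ + X]big1 ?addr0 => [|y yx].
    under eq_bigr do rewrite mulrA [ch (- _) x * _]mulrC chVK // mul1r.
    by rewrite sumr_const mulr_natl.
  under eq_bigr do rewrite mulrA -chV -chM.
  rewrite -mulr_suml sum_ch_dual ifN ?mul0r //.
  by apply: contra_neq yx => /(congr1 ( *%R x)); rewrite mulrA divff // mul1r mulr1.
have n0 : #|R|%:R != 0 :> algC by rewrite pnatr_eq0 -lt0n; apply/card_gt0P; exists 0.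
apply: (mulfI n0); rewrite -!inv; apply: eq_bigr => c _; by rewrite uv.
Qed.

Lemma jacobi_linear c d (a b : F) : a != 0 -> b != 0 ->
  \sum_x ch c x * ch d (b + a * x) = ch c (- b / a) * ch d b * J c d.
Proof.
move=> a0 b0; have k0 : - b / a != 0 by rewrite mulf_neq0 ?oppr_eq0 ?invr_eq0.
rewrite -(sum_dilate _ k0) /J /jacobi mulr_sumr; apply: eq_bigr => x _.
have -> : b + a * (- b / a * x) = b * (1 - x) by field.
by rewrite !chM; ring.
Qed.

(** The substitution [x = t / (1 + t)] turns the summand into [ch a t] with [t] running over all
    elements but -1; the complete sum of [ch a] is 0, so minus the missing term remains. *)
Lemma jacobi_opp a : a != 0 -> J a (- a) = - sg a.
Proof.
move=> a0; rewrite /J /jacobi (bigD1 1) //= subrr chz mulr0 add0r.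
have -> : - sg a = \sum_(t | t != -1) ch a t.
  have := sum_ch a; rewrite (negPf a0) (bigD1 (-1)) //= => /eqP.
  by rewrite addrC addr_eq0 => /eqP ->.
rewrite (reindex_onto (fun t => t / (1 + t)) (fun x => x / (1 - x))) /=; last first.
  move=> x x1; rewrite -subr_eq0 in x1; field.
  by rewrite addrNK oner_eq0 andbT -oppr_eq0 opprB.
apply: eq_big => [t|t /andP[]].
  case: (eqVneq t (-1)) => [->|t1].
    rewrite subrr invr0 mulr0 subr0 mul0r eq_sym oner_eq0 /=.
    by rewrite eq_sym oppr_eq0 oner_eq0.
  have t0 : 1 + t != 0 by rewrite addrC -(opprK 1) subr_eq0.
  have -> : t / (1 + t) / (1 - t / (1 + t)) = t.
    by field; rewrite t0 addrK oner_neq0.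
  rewrite eqxx andbT -subr_eq0; have -> : t / (1 + t) - 1 = - (1 + t)^-1 by field.
  by rewrite oppr_eq0 invr_eq0.
case: (eqVneq (1 + t) 0) => [->|t0 _ _].
  by rewrite invr0 mulr0 mul0r => _ /eqP <-; rewrite !chz mul0r.
have -> : 1 - t / (1 + t) = (1 + t)^-1 by field.
by rewrite chM [ch (- a) _]chV opprK chV -mulrA [ch (-a) _ * _]mulrC chVK ?mulr1.
Qed.


(** * Gauss and Jacobi sums *)

Lemma sum_psi (a : F) : \sum_x psi (a * x) = if a == 0 then q else 0.
Proof.
case: eqVneq => [->|a0].
  by rewrite (eq_bigr (fun=> 1)) => [|x _]; rewrite ?mul0r ?psi0 // sumr_const.
rewrite (sum_dilate psi a0); case: psi_nontriv => y y1.
apply: (mulfI (_ : psi y - 1 != 0)); first by rewrite subr_eq0.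
rewrite mulr0 mulrBl mul1r mulr_sumr.
under eq_bigr do rewrite -psiD addrC.
by rewrite (sum_shift y psi) subrr.
Qed.

Lemma sum_psi_neq0 (a : F) : \sum_(x | x != 0) psi (a * x) = (if a == 0 then q else 0) - 1.
Proof. by rewrite -sum_psi [in RHS](bigD1 0) //= mulr0 psi0 addrAC subrr add0r. Qed.

Lemma gauss0 : g 0 = -1.
Proof.
rewrite /g (bigD1 0) //= chz mul0r add0r.
rewrite (eq_bigr (fun x => psi (1 * x))) => [|x x0]; last by rewrite ch0 // !mul1r.
by rewrite sum_psi_neq0 oner_eq0 add0r.
Qed.

Lemma gauss_dilate c (a : F) : a != 0 -> \sum_x ch c x * psi (a * x) = ch (- c) a * g c.
Proof.
move=> a0; rewrite -(sum_dilate _ (_ : a^-1 != 0)) ?invr_eq0 // mulr_sumr.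
apply: eq_bigr => x _; rewrite chM chV mulrA divff // mul1r; ring.
Qed.

(** Terms are grouped by [s = x + y]. For [s != 0], scaling by [s] splits off a Jacobi sum; [s = 0]
    leaves a complete character sum, nonzero only when [a + b = 0]. *)
Lemma gaussM a b :
  g a * g b = g (a + b) * J a b + (if a + b == 0 then sg b * (q - 1) else 0).
Proof.
rewrite /g mulr_suml; under eq_bigr do rewrite mulr_sumr.
have -> : \sum_x \sum_y ch a x * psi x * (ch b y * psi y) =
          \sum_s psi s * \sum_x ch a x * ch b (s - x).
  under [RHS]eq_bigr do rewrite mulr_sumr.
  rewrite [RHS]exchange_big; apply: eq_bigr => x _ /=.
  rewrite -[RHS](sum_shift x); apply: eq_bigr => y _.
  by rewrite addrK psiD; ring.
rewrite (bigD1 0) //= psi0 mul1r addrC; congr (_ + _).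
  rewrite mulr_suml [RHS](bigD1 0) //= chz !mul0r add0r.
  apply: eq_bigr => s s0; rewrite -(sum_dilate _ s0) mulrC mulr_suml /J /jacobi.
  rewrite mulr_sumr; apply: eq_bigr => x _.
  have -> : s - s * x = s * (1 - x) by ring.
  by rewrite !chM chD; ring.
under eq_bigr do rewrite sub0r chN mulrCA -chD.
by rewrite -mulr_sumr sum_ch; case: ifP; rewrite ?mulr0.
Qed.

Lemma gaussK c : g c * g (- c) = sg c * Nm c.
Proof.
rewrite /Nm; case: eqVneq => [->|c0].
  by rewrite oppr0 gauss0 mulrNN !mulr1 /sg ch0 // oppr_eq0 oner_eq0.
by rewrite gaussM subrr eqxx gauss0 jacobi_opp // sgN; ring.
Qed.

Lemma Nm_neq0 c : Nm c != 0.
Proof. by rewrite /Nm; case: ifP; rewrite ?oner_neq0. Qed.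

Lemma gauss_neq0 c : g c != 0.
Proof.
apply/eqP=> c0; have := gaussK c; rewrite c0 mul0r => /esym/eqP; apply/negP.
by rewrite mulf_neq0 ?Nm_neq0 // ch_neq0 // oppr_eq0 oner_eq0.
Qed.

(** Multiplying by [g (- (a + b))] instead of dividing by [g (a + b)] gives one formula that also
    covers [a + b = 0], as long as [a] and [b] are not both 0. *)
Lemma jacobi_gauss a b : (a != 0) || (b != 0) ->
  q * J a b = sg (a + b) * (g a * g b * g (- (a + b))).
Proof.
move=> ab; have [s0|s0] := eqVneq (a + b) 0.
  have bE : b = - a by apply/eqP; rewrite -addr_eq0 addrC s0.
  have a0 : a != 0 by move: ab; rewrite bE oppr_eq0 orbb.
  rewrite s0 oppr0 bE gaussK jacobi_opp // gauss0 /Nm (negPf a0) /sg ch0 ?oppr_eq0 ?oner_eq0 //.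
  by ring.
rewrite gaussM (negPf s0) addr0 [X in sg _ * X]mulrAC gaussK /Nm (negPf s0).
by rewrite -[LHS]mul1r -(sgK (a + b)); ring.
Qed.

Lemma sg_neq0 c : sg c != 0.
Proof. by rewrite ch_neq0 // oppr_eq0 oner_eq0. Qed.

Lemma Nm_q c : c != 0 -> Nm c = q.
Proof. by rewrite /Nm => /negPf ->. Qed.

(** * Hasse-Davenport relations *)

Section Quadratic.
Variable h : R.
Hypotheses (h2 : 2 * h = 0) (h0 : h != 0).
Hypothesis two0 : 2 != 0 :> F.

Lemma ch_order2_gen : ch h gam = -1.
Proof.
have: ch h gam ^+ 2 = 1 by rewrite -ch_mulr ?h2 ?ch0 // (cf_gam chF).
move/eqP; rewrite sqrf_eq1 => /orP[/eqP /(cf_inj chF) hh|/eqP//].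
by move: h0; rewrite hh eqxx.
Qed.

Lemma index_order2 c : 2 * c = 0 -> c = 0 \/ c = h.
Proof.
move=> c2; have: ch c gam ^+ 2 = 1 by rewrite -ch_mulr ?c2 ?ch0 // (cf_gam chF).
move/eqP; rewrite sqrf_eq1 => /orP[/eqP /(cf_inj chF)|/eqP cg]; [by left|right].
apply/eqP; rewrite -subr_eq0; apply/eqP/(cf_inj chF).
rewrite chD cg -chV; apply: (mulIf (ch_neq0 h (cf_gam chF))).
by rewrite -mulrA -chM mulVf ?(cf_gam chF) // ch1 ch_order2_gen mulr1 mul1r.
Qed.

Lemma ch_order2_sqr x : x != 0 -> ch h (x ^+ 2) = 1.
Proof. by move=> x0; rewrite -ch_mul2 h2 ch0. Qed.

Lemma ch_order2_val x : x != 0 -> ch h x = 1 \/ ch h x = -1.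
Proof.
move=> /(cf_gen chF) [i ->]; rewrite chX ch_order2_gen -signr_odd.
by case: odd; [right|left].
Qed.

Lemma order2_sqrt x : ch h x = 1 -> exists s, x = s ^+ 2.
Proof.
have [->|x0] := eqVneq x 0; first by exists 0; rewrite expr0n.
case: (cf_gen chF x0) => i ->; rewrite chX ch_order2_gen -signr_odd => hi.
exists (gam ^+ i./2); rewrite -exprM muln2 -[in LHS](odd_double_half i).
case: odd hi => //= /eqP; rewrite expr1.
by rewrite eqNr oner_eq0.
Qed.

(** [1 + ch h v] is the number of square roots of [v], also at [v = 0]. *)
Lemma sum_sqr (f : F -> algC) : \sum_s f (s ^+ 2) = \sum_v (1 + ch h v) * f v.
Proof.
rewrite (partition_big (fun s => s ^+ 2) predT) //; apply: eq_bigr => v _.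
rewrite (eq_bigl (mem [set s | s ^+ 2 == v])) => [|s]; last by rewrite !inE.
rewrite (eq_bigr (fun=> f v)) => [|s]; last by rewrite !inE => /eqP ->.
rewrite sumr_const -[LHS]mulr_natl; congr (_ * _).
have [->|v0] := eqVneq v 0.
  rewrite chz addr0 (eq_card (B := pred1 0)) ?card1 // => s.
  by rewrite !inE expf_eq0.
case: (ch_order2_val v0) => hv; rewrite hv.
  case: (order2_sqrt hv) => s vE.
  have s0 : s != 0 by apply: contraNneq v0 => s0; rewrite vE s0 expr0n.
  rewrite (eq_card (B := [set s; - s])) => [|t].
    suff -> : #|[set s; - s]| = 2%N by [].
    rewrite cards2; have -> // : s != - s.
    by rewrite -subr_eq0 opprK -mulr2n -mulr_natl mulf_neq0.
  by rewrite !inE vE eqf_sqr.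
rewrite subrr (eq_card (B := pred0)) ?card0 // => s; apply/negP; rewrite inE => /eqP vE.
have s0 : s != 0 by apply: contraNneq v0 => s0; rewrite -vE s0 expr0n.
have := ch_order2_sqr s0; rewrite vE hv => /eqP.
by rewrite eqNr oner_eq0.
Qed.

(** Completing the square: [4 t (1 - t) = 1 - s ^ 2] for [s = 2 t - 1]. The sum over [s] is then
    evaluated by counting square roots. *)
Lemma jacobi_dup c : c != 0 -> ch c 4 * J c c = J h c.
Proof.
move=> c0; transitivity (\sum_s ch c (1 - s ^+ 2)).
  rewrite -(sum_shift (-1)) -(sum_dilate _ two0) mulr_sumr.
  apply: eq_bigr => t _; rewrite -!chM; congr (ch c _); ring.
rewrite (sum_sqr (fun v => ch c (1 - v))).
under eq_bigr do rewrite mulrDl mul1r.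
by rewrite big_split /= (sum_reflect 1) sum_ch (negPf c0) add0r.
Qed.

Lemma four_neq0 : 4 != 0 :> F.
Proof. have -> : 4 = 2 * 2 :> F by ring.
by rewrite mulf_neq0. Qed.

(** Hasse-Davenport for 2: [jacobi_dup] in terms of Gauss sums. The indices 0 and [h], where [2 * d]
    vanishes, are direct. *)
Lemma gauss_dup d : g d * g (d + h) * ch d 4 = g (2 * d) * g h.
Proof.
have [->|d0] := eqVneq d 0; first by rewrite mulr0 add0r ch0 ?mulr1 // four_neq0.
have [->|dh] := eqVneq d h.
  have -> : h + h = 0 by rewrite -[RHS]h2; ring.
  have -> : 4 = 2 ^+ 2 :> F by ring.
  by rewrite ch_order2_sqr // h2 mulr1 mulrC.
have d2 : 2 * d != 0 by apply/eqP => /index_order2 [] /eqP; apply/negP.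
have hd : d + h != 0.
  apply: contra_neq dh => dh0; apply/eqP; rewrite -subr_eq0 -dh0 -subr_eq0.
  have -> : d - h - (d + h) = - (2 * h) by ring.
  by rewrite h2 oppr0.
have E := congr1 ( *%R q) (jacobi_dup d0).
rewrite mulrCA !jacobi_gauss ?d0 ?orbT // in E.
have dd : d + d = 2 * d by ring.
rewrite dd sg2 mul1r in E.
apply: (mulfI (gauss_neq0 d)); apply: (mulfI (gauss_neq0 (- (2 * d)))).
have K1 := gaussK (2 * d); have K2 := gaussK (d + h).
rewrite sg2 mul1r Nm_q // in K1; rewrite Nm_q // in K2.
have -> : g (- (2 * d)) * (g d * (g d * g (d + h) * ch d 4)) =
  (ch d 4 * (g d * g d * g (- (2 * d)))) * g (d + h) by ring.
rewrite E addrC.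
transitivity (sg (d + h) * (g h * g d) * (g (d + h) * g (- (d + h)))); first by ring.
rewrite K2 -K1 -[RHS]mul1r -[1 in RHS](sgK (d + h)); ring.
Qed.
End Quadratic.

(** * Complex conjugates and absolute values *)

Lemma ch_norm c x : x != 0 -> `|ch c x| = 1.
Proof.
move=> x0; apply/eqP; 
have n0 : (0 < #|F|.-1)%N.
  by rewrite -(cardC1 (0 : F)); apply/card_gt0P; exists 1; rewrite inE oner_neq0.
rewrite -(pexpr_eq1 n0) ?normr_ge0 // -normrX -chX.
have -> : x ^+ #|F|.-1 = 1.
  apply: (mulfI x0); rewrite -exprS prednK ?expf_card ?mulr1 //.
  by apply/card_gt0P; exists 0.
by rewrite ch1 normr1.
Qed.

Lemma ch_conj c x : (ch c x)^* = ch (- c) x.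
Proof.
have [->|x0] := eqVneq x 0; first by rewrite !chz conjC0.
apply: (mulfI (ch_neq0 c x0)); by rewrite chVK // -normCK ch_norm // expr1n.
Qed.

Lemma psi_conj x : (psi x)^* = psi (- x).
Proof.
have p0 : psi x != 0.
  apply/eqP=> p; have := psiD x (- x); rewrite subrr psi0 p mul0r => /eqP.
  by rewrite oner_eq0.
have pX n : psi (x *+ n) = psi x ^+ n.
  by elim: n => [|n IH]; rewrite ?mulr0n ?psi0 // mulrS exprS psiD IH.
have c0 : (0 < #|F|)%N by apply/card_gt0P; exists 0.
have pn : `|psi x| = 1.
  apply/eqP; rewrite -(pexpr_eq1 c0) ?normr_ge0 // -normrX -pX.
  suff -> : x *+ #|F| = 0 by rewrite psi0 normr1.
  apply: (addrI (\sum_y y)); rewrite addr0 -[in RHS](sum_shift x) big_split /=.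
  by rewrite sumr_const.
apply: (mulfI p0); by rewrite -normCK pn expr1n -psiD subrr psi0.
Qed.

Lemma gauss_conj c : (g c)^* = sg c * g (- c).
Proof.
rewrite rmorph_sum /= -(sum_reflect 0) mulr_sumr; apply: eq_bigr => x _.
by rewrite sub0r rmorphM /= ch_conj psi_conj opprK chN sgN -mulrA.
Qed.

Lemma gauss_norm c : `|g c| ^+ 2 = Nm c.
Proof. by rewrite normCK gauss_conj mulrCA gaussK mulrA sgK mul1r. Qed.

(** * Characters of order 3 and triplication of Gauss sums *)

Section Cubic.
Variable w : R.
Hypotheses (w3 : 3 * w = 0) (w0 : w != 0).
Hypothesis three0 : 3 != 0 :> F.

Lemma index_order3 c : 3 * c = 0 -> [\/ c = 0, c = w | c = - w].
Proof.
move=> c3; have g0 := cf_gam chF.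
have cu : ch c gam ^+ 3 = 1 by rewrite -ch_mulr ?c3 ?ch0.
have wu : ch w gam ^+ 3 = 1 by rewrite -ch_mulr ?w3 ?ch0.
have w1 : ch w gam - 1 != 0.
  by rewrite subr_eq0; apply: contra_neq w0; apply: (cf_inj chF).
set u := ch c gam in cu *; set z := ch w gam in wu w1.
have zs : z ^+ 2 + z + 1 = 0.
  apply: (mulfI w1); rewrite mulr0.
  have -> : (z - 1) * (z ^+ 2 + z + 1) = z ^+ 3 - 1 by ring.
  by rewrite wu subrr.
have : (u - 1) * ((u - z) * (u - z ^+ 2)) = 0.
  have -> : (u - 1) * ((u - z) * (u - z ^+ 2)) =
    u ^+ 3 - u ^+ 2 * (z ^+ 2 + z + 1) + u * (z ^+ 3 + (z ^+ 2 + z + 1) - 1) - z ^+ 3.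
    by ring.
  by rewrite zs wu cu; ring.
have eqI a b : ch a gam = ch b gam -> a = b.
  move=> ab; apply/eqP; rewrite -subr_eq0; apply/eqP/(cf_inj chF).
  by rewrite chD ab chVK.
move/eqP; rewrite !mulf_eq0 !subr_eq0 => /or3P[] /eqP uE.
- by apply: Or31; apply: (cf_inj chF).
- by apply: Or32; apply: eqI.
apply: Or33; apply: eqI; rewrite -[LHS]/u uE.
have -> : - w = 2 * w - 3 * w by ring.
by rewrite w3 subr0 ch_mulr.
Qed.

(** At most one of [c], [c + w], [c - w] is 0, and one is exactly when [3 * c = 0]. *)
Lemma Nm_cubic c : Nm c * Nm (c + w) * Nm (c - w) = q ^+ 2 * Nm (3 * c).
Proof.
have ww : w + w != 0.
  apply: contra_neq w0 => ww; transitivity (3 * w - (w + w)); first by ring.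
  by rewrite w3 ww subr0.
have [c3|c3] := eqVneq (3 * c) 0; last first.
  have c0 : c != 0 by apply: contra_neq c3 => ->; rewrite mulr0.
  have cw : c + w != 0.
    by apply: contra_neq c3 => cw; rewrite -[RHS](mulr0 3) -cw mulrDr w3 addr0.
  have cw' : c - w != 0.
    by apply: contra_neq c3 => cw'; rewrite -[RHS](mulr0 3) -cw' mulrBr w3 subr0.
  by rewrite !Nm_q //; ring.
have N0 : Nm 0 = 1 by rewrite /Nm eqxx.
have nw : - w != 0 by rewrite oppr_eq0.
case: (index_order3 c3) => ->.
- by rewrite mulr0 add0r sub0r N0 !Nm_q //; ring.
- by rewrite w3 subrr N0 !Nm_q //; ring.
have -> : 3 * - w = - (3 * w) by ring.
by rewrite w3 oppr0 addNr N0 !Nm_q // -?opprD ?oppr_eq0 //; ring.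
Qed.

Lemma sum_prod3 (A B D : F -> algC) :
  (\sum_a A a) * (\sum_b B b) * (\sum_d D d) =
  \sum_b \sum_d \sum_a A a * B b * D d.
Proof.
under [RHS]eq_bigr do under eq_bigr do rewrite -!mulr_suml.
under [RHS]eq_bigr do rewrite -mulr_sumr.
by rewrite -mulr_suml -mulr_sumr.
Qed.

(** Expanding the conjugate factor over [t] and scaling the other variables by [t] leaves
    [psi ((a + b + d - 1) * t)], so summing over [t] imposes [a + b + d = 1]. The missing [t = 0]
    would add the product in [sums0], which is 0. Scaling [b] and [d] by 1/3 absorbs [ch c 27]. *)
Lemma gauss_triple_sum c :
  ch c 27 * (g c * g (c + w) * g (c - w)) * (g (3 * c))^* =
  q * \sum_b \sum_d ch c ((3 - b - d) * b * d) * (ch w b * ch (- w) d).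
Proof.
have sums0 : (\sum_a ch c a) * (\sum_b ch (c + w) b) * (\sum_d ch (c - w) d) = 0.
  rewrite !sum_ch; have [c0|c0] := eqVneq c 0; last by rewrite !mul0r.
  by rewrite c0 add0r (negPf w0) mulr0 mul0r.
have tri : g c * g (c + w) * g (c - w) * (g (3 * c))^* =
  \sum_(t | t != 0) \sum_b \sum_d \sum_a
     ch c a * ch (c + w) b * ch (c - w) d * psi ((a + b + d - 1) * t).
  rewrite rmorph_sum mulr_sumr (bigD1 0) //= chz mul0r conjC0 mulr0 add0r.
  apply: eq_bigr => t t0; rewrite rmorphM /= ch_conj psi_conj.
  transitivity (psi (- t) * ((\sum_x ch c x * psi (t * x)) *
     (\sum_x ch (c + w) x * psi (t * x)) * (\sum_x ch (c - w) x * psi (t * x)))).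
    rewrite !gauss_dilate //.
    have -> : - (3 * c) = - c + - (c + w) + - (c - w) by ring.
    by rewrite !chD; ring.
  rewrite sum_prod3 mulr_sumr; apply: eq_bigr => b _.
  rewrite mulr_sumr; apply: eq_bigr => d _; rewrite mulr_sumr; apply: eq_bigr => a _.
  have -> : (a + b + d - 1) * t = - t + t * a + t * b + t * d by ring.
  by rewrite !psiD; ring.
rewrite -mulrA tri exchange_big /=.
transitivity (ch c 27 * (\sum_b \sum_d \sum_a (ch c a * ch (c + w) b * ch (c - w) d *
  (if a + b + d - 1 == 0 then q else 0)) - \sum_b \sum_d \sum_a
  ch c a * ch (c + w) b * ch (c - w) d)).
  congr (_ * _); rewrite -sumrB; apply: eq_bigr => b _.
  rewrite exchange_big -sumrB; apply: eq_bigr => d _ /=.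
  rewrite exchange_big -sumrB; apply: eq_bigr => a _ /=.
  by rewrite -mulr_sumr sum_psi_neq0 mulrBr mulr1.
have k0 : 3^-1 != 0 :> F by rewrite invr_eq0.
rewrite -sum_prod3 sums0 subr0 mulr_sumr mulr_sumr -(sum_dilate _ k0); apply: eq_bigr => b _.
rewrite !mulr_sumr -(sum_dilate _ k0); apply: eq_bigr => d _.
rewrite (bigD1 (1 - 3^-1 * b - 3^-1 * d)) //= big1 ?addr0 => [|a ne]; last first.
  rewrite ifN ?mulr0 //; apply: contraNN ne => /eqP E.
  by rewrite -subr_eq0 -E; apply/eqP; ring.
rewrite ifT; last by apply/eqP; ring.
have -> : (3 - b - d) * b * d = 27 * (1 - 3^-1 * b - 3^-1 * d) * (3^-1 * b) * (3^-1 * d).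
  by field.
have -> : ch w b * ch (- w) d = ch w (3^-1 * b) * ch (- w) (3^-1 * d).
  transitivity (ch w 3^-1 * ch (- w) 3^-1 * (ch w b * ch (- w) d)).
    by rewrite chVK // mul1r.
  by rewrite !chM; ring.
by rewrite !chD !chM; ring.
Qed.

(* The curve [a b d = 1], [a + b + d = 3] is a cubic with a node at [(1, 1, 1)];
   the lines through the node parametrize it, with [d = t ^ 3 * b]. *)
Lemma nodal_cubic_sum :
  \sum_b \sum_(d | (3 - b - d) * b * d == 1) ch w b * ch (- w) d =
  q - \sum_(z : F | z ^+ 3 == 1) 1.
Proof.
(* With [b = u + 1] and [d = u * t + 1], [t] is the slope of a line through the node. The node is
   the only point with [b = 1] and is split off as [u = 0]. *)
rewrite -(sum_shift 1) (bigD1 0) //= add0r.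
have -> : \sum_(d : F | (3 - 1 - d) * 1 * d == 1) ch w 1 * ch (- w) d = 1.
  rewrite (big_pred1 1) => [|d]; first by rewrite !ch1 mulr1.
  rewrite -subr_eq0 -[RHS]subr_eq0 -[RHS]orbb -mulf_eq0 -oppr_eq0.
  by congr (_ == 0); ring.
have -> : \sum_(u | u != 0) \sum_(d | (3 - (u + 1) - d) * (u + 1) * d == 1)
    ch w (u + 1) * ch (- w) d =
  \sum_(t : F) \sum_(u : F | (u != 0) && (t * (1 + t) * u == - (1 + t + t ^+ 2))) 1.
  rewrite [RHS](exchange_big_dep (fun u => u != 0)) /= => [|t u _ /andP[]//].
  apply: eq_bigr => u u0; rewrite big_mkcond /= -(sum_shift 1) -(sum_dilate _ u0) [RHS]big_mkcond.
  apply: eq_bigr => t _; rewrite u0 /=.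
  have PE : ((3 - (u + 1) - (u * t + 1)) * (u + 1) * (u * t + 1) == 1) =
            (t * (1 + t) * u == - (1 + t + t ^+ 2)).
    rewrite -subr_eq0 -[RHS]subr_eq0 -oppr_eq0.
    have -> : - ((3 - (u + 1) - (u * t + 1)) * (u + 1) * (u * t + 1) - 1) =
      u ^+ 2 * (t * (1 + t) * u - - (1 + t + t ^+ 2)) by ring.
    by rewrite mulf_eq0 expf_eq0 (negPf u0).
  rewrite -PE; case: ifP => // E; have := E; rewrite PE => /eqP tu.
  have dE : u * t + 1 = t ^+ 3 * (u + 1).
    apply/eqP; rewrite -subr_eq0.
    have -> : u * t + 1 - t ^+ 3 * (u + 1) =
       (1 - t) * (t * (1 + t) * u - - (1 + t + t ^+ 2)) by ring.
    by rewrite tu subrr mulr0.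
  have : (3 - (u + 1) - (u * t + 1)) * (u + 1) * (u * t + 1) != 0.
    by rewrite (eqP E) oner_neq0.
  rewrite dE !mulf_eq0 !negb_or => /andP[/andP[_ b0] /andP[/andP[t0 _] _]].
  rewrite chM mulrCA chVK // mulr1 chX -ch_mulr //.
  have -> : 3 * - w = - (3 * w) by ring.
  by rewrite w3 oppr0 ch0.
(* The line of slope [t] meets the curve in one further point, except that there is none for [t = 0]
   and [t = -1], and that it falls back on the node when [1 + t + t ^ 2 = 0]. The last term corrects
   for [t = 1], a cube root of 1 at which [1 + t + t ^ 2] is 3. *)
have cnt (t : F) : \sum_(u | (u != 0) && (t * (1 + t) * u == - (1 + t + t ^+ 2))) 1 =
  1 - (t == 0)%:R - (t == -1)%:R - (t ^+ 3 == 1)%:R + (t == 1)%:R :> algC.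
  have [->|t0] := eqVneq t 0.
    rewrite big_pred0 => [|u]; last first.
      by rewrite !mul0r expr0n !addr0 [0 == _]eq_sym oppr_eq0 oner_eq0 andbF.
    rewrite expr0n /= [0 == -1]eq_sym oppr_eq0 [0 == 1]eq_sym oner_eq0.
    by rewrite subrr !subr0 addr0.
  have [->|t1] := eqVneq t (-1).
    rewrite big_pred0 => [|u]; last first.
      by rewrite subrr mulr0 mul0r sqrrN expr1n add0r [0 == _]eq_sym oppr_eq0 oner_eq0 andbF.
    have -> : (-1) ^+ 3 = -1 :> F by ring.
    by rewrite /= subr0 subrr sub0r addNr.
  have s0 : t * (1 + t) != 0 by rewrite mulf_neq0 // addrC -[1]opprK subr_eq0.
  rewrite !subr0; have [t2|t2] := eqVneq (1 + t + t ^+ 2) 0.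
    rewrite big_pred0 => [|u]; last first.
      by rewrite t2 oppr0 mulf_eq0 (negPf s0) /= andNb.
    have -> : t ^+ 3 = 1.
      apply/eqP; rewrite -subr_eq0; have -> : t ^+ 3 - 1 = (t - 1) * (1 + t + t ^+ 2) by ring.
      by rewrite t2 mulr0.
    have [tE|tN] := eqVneq t 1; last by rewrite eqxx subrr addr0.
    move/eqP: t2; rewrite tE; have -> : 1 + 1 + 1 ^+ 2 = 3 :> F by ring.
    by rewrite (negPf three0).
  rewrite (big_pred1 (- (1 + t + t ^+ 2) / (t * (1 + t)))) => [|u]; last first.
    rewrite -[t * (1 + t) * u]mulrC -[RHS](inj_eq (mulIf s0)) mulfVK //.
    case: (eqVneq u 0) => //= ->; by rewrite mul0r eq_sym oppr_eq0 (negPf t2).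
  have -> : (t ^+ 3 == 1) = (t == 1).
    rewrite -subr_eq0; have -> : t ^+ 3 - 1 = (t - 1) * (1 + t + t ^+ 2) by ring.
    by rewrite mulf_eq0 (negPf t2) orbF subr_eq0.
  by rewrite subrK.
rewrite (eq_bigr _ (fun t _ => cnt t)).
rewrite big_split !sumrB /=.
have S1 (y : F) : \sum_(t : F) (t == y)%:R = 1 :> algC.
  rewrite (bigD1 y) //= eqxx big1 ?addr0 // => t /negPf -> //.
have S3 : \sum_(t : F) (t ^+ 3 == 1)%:R = \sum_(z : F | z ^+ 3 == 1) 1 :> algC.
  by rewrite [RHS]big_mkcond; apply: eq_bigr => t _; case: eqP.
have S0 : \sum_(t : F) 1 = q by rewrite sumr_const.
by rewrite !S1 S3 S0; ring.
Qed.

(* Hasse-Davenport for the prime 3: the norms of both sides agree for each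
   character, so it is enough to compare their sums over all characters, and
   orthogonality reduces that to the point count on the nodal cubic. *)
Lemma gauss_triple d : g d * g (d + w) * g (d - w) * ch d 27 = q * g (3 * d).
Proof.
pose A c := ch c 27 * (g c * g (c + w) * g (c - w)) * (g (3 * c))^*.
(* Multiplied by the conjugate of [g (3 * d)], the right-hand side is real and nonnegative, so that
   the equality case of the triangle inequality can be used. *)
suff E : A d = q * Nm (3 * d).
  have c0 : (g (3 * d))^* != 0 by rewrite conjC_eq0 gauss_neq0.
  apply: (mulIf c0); rewrite -[RHS]mulrA -normCK gauss_norm -E /A; ring.
have t27 : 27 != 0 :> F.
  have -> : 27 = 3 * 3 * 3 :> F by ring.
  by rewrite !mulf_neq0.
apply: (normC_sum_upper (P := predT) (F := A) (G := fun c => q * Nm (3 * c))) => // [c _|].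
  have Nge0 a : 0 <= Nm a by rewrite -gauss_norm exprn_ge0.
  suff -> : `|A c| = q * Nm (3 * c) by [].
  apply/eqP; rewrite -(@eqrXn2 _ 2) ?mulr_ge0 ?normr_ge0 ?ler0n //.
  rewrite /A !normrM !exprMn norm_conjC !gauss_norm ch_norm // expr1n mul1r Nm_cubic.
  by apply/eqP; ring.
under eq_bigr do rewrite /A gauss_triple_sum.
rewrite -!mulr_sumr; congr (_ * _).
rewrite exchange_big /=; under eq_bigr do rewrite exchange_big /=.
under eq_bigr do under eq_bigr do rewrite -mulr_suml sum_ch_dual.
transitivity (#|R|%:R * \sum_b \sum_(d | (3 - b - d) * b * d == 1) ch w b * ch (- w) d).
  rewrite mulr_sumr; apply: eq_bigr => b _; rewrite mulr_sumr [RHS]big_mkcond.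
  by apply: eq_bigr => a _; case: ifP; rewrite ?mul0r.
rewrite nodal_cubic_sum.
transitivity (\sum_c (q - \sum_z ch c (z ^+ 3))).
  rewrite mulrBr [RHS]sumrB; congr (_ - _); first by rewrite sumr_const mulr_natl.
  rewrite [RHS]exchange_big mulr_sumr [LHS]big_mkcond; apply: eq_bigr => z _.
  by rewrite sum_ch_dual mulr1.
apply: eq_bigr => c _.
have -> : \sum_z ch c (z ^+ 3) = \sum_z ch (3 * c) z.
  apply: eq_bigr => z _; have [->|z0] := eqVneq z 0; first by rewrite expr0n !chz.
  by rewrite chX ch_mulr.
by rewrite sum_ch /Nm; case: ifP => _; ring.
Qed.
End Cubic.

Lemma sgP c : sg c = 1 \/ sg c = -1.
Proof.
have /eqP := sgK c; rewrite -expr2 sqrf_eq1 => /orP[] /eqP; by [left|right].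
Qed.

Lemma gaussN_inv a b : a != 0 -> b = - a -> g b = sg a * q / g a.
Proof.
move=> a0 ->; apply: (mulfI (gauss_neq0 a)); rewrite gaussK Nm_q //.
by field; rewrite gauss_neq0.
Qed.

(** The index [s] is an argument of its own, so that each use can supply it in reduced form. *)
Lemma jacobi_gauss_inv a b s : (a != 0) || (b != 0) -> s = - (a + b) ->
  J a b = sg s * (g a * g b * g s) / q.
Proof.
move=> ab ->; apply: (mulfI q0); rewrite jacobi_gauss // sgN.
by field.
Qed.

Lemma jacobi00 : J 0 0 = q - 2.
Proof.
rewrite /J /jacobi (bigD1 0) //= chz mul0r add0r (bigD1 1) ?oner_neq0 //= subrr chz mulr0 add0r.
rewrite (eq_bigr (fun=> 1)) => [|x /andP[x0 x1]]; last first.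
  by rewrite !ch0 ?mulr1 // subr_eq0 eq_sym.
apply: (addIr 2); rewrite subrK.
have -> : q = \sum_(x : F) 1 by rewrite sumr_const.
rewrite [RHS](bigD1 0) //= [in RHS](bigD1 1) ?oner_neq0 //=; ring.
Qed.

(** * The period function with parameters of order 24 *)

Section Octahedral.
Variable e : R.
Hypotheses (e24 : 24 * e = 0) (e12 : 12 * e != 0) (e8 : 8 * e != 0).
Hypotheses (two0 : 2 != 0 :> F) (three0 : 3 != 0 :> F).

(** Indices matter only modulo [24 * e]; the multiplier [k] given at each use reduces a congruence
    to an identity for [ring]. *)
Lemma index_eq (k a b : R) : a - b = k * (24 * e) -> a = b.
Proof. by rewrite e24 mulr0 => /eqP; rewrite subr_eq0 => /eqP. Qed.

Lemma index_neq0 (k j a : R) : k * a = 12 * e + j * (24 * e) -> a != 0.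
Proof. by rewrite e24 mulr0 addr0; apply: contra_eq_neq => ->; rewrite mulr0 eq_sym. Qed.

Lemma sg_mulr n c : sg (n%:R * c) = if odd n then sg c else 1.
Proof.
have -> : n%:R * c = (odd n)%:R * c + 2 * (n./2%:R * c).
  by rewrite -[n in LHS]odd_double_half natrD -muln2 natrM; ring.
rewrite sgD sg2 mulr1.
by case: odd; rewrite ?mul1r // mul0r /sg ch0 // oppr_eq0 oner_eq0.
Qed.

Let h2 : 2 * (12 * e) = 0. Proof. by rewrite -[RHS]e24; ring. Qed.
Let w3 : 3 * (8 * e) = 0. Proof. by rewrite -[RHS]e24; ring. Qed.

Let sge := (sgD, sgN, sg_mulr).

Let e3 : 3 * e != 0. Proof. by apply: (@index_neq0 4 0); ring. Qed.
Let e6 : 6 * e != 0. Proof. by apply: (@index_neq0 2 0); ring. Qed.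
Let e9 : 9 * e != 0. Proof. by apply: (@index_neq0 4 1); ring. Qed.
Let e1 : e != 0. Proof. by apply: (@index_neq0 12 0); ring. Qed.
Let e11 : 11 * e != 0. Proof. by apply: (@index_neq0 12 5); ring. Qed.
Let e7 : 7 * e != 0. Proof. by apply: (@index_neq0 12 3); ring. Qed.

Lemma gauss12K : g (12 * e) * g (12 * e) = q.
Proof.
have {2}-> : 12 * e = - (12 * e) by apply: (@index_eq 1); ring.
by rewrite gaussK Nm_q // sg_mulr mul1r.
Qed.

(** * Mellin transforms of the period function and of the double sum *)

Let f (l : F) := \sum_y ch (7 * e) y * ch (11 * e) (1 - y) * ch e (1 - l * y).
Let fhat c := \sum_l ch c l * f l.

Lemma fhatE c : fhat c = J (7 * e - c) (11 * e) * J c e.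
Proof.
rewrite /fhat /f; under eq_bigr do rewrite mulr_sumr.
rewrite exchange_big /= /J {1}/jacobi mulr_suml; apply: eq_bigr => y _.
have [->|y0] := eqVneq y 0.
  by rewrite !chz !mul0r big1 // => l _; rewrite !mul0r mulr0.
under eq_bigr do rewrite mulrCA.
rewrite -mulr_sumr.
have -> : \sum_l ch c l * ch e (1 - l * y) = ch (- c) y * J c e.
  have ny : - y != 0 by rewrite oppr_eq0.
  have := jacobi_linear c e ny (oner_neq0 F).
  have -> : - (1 : F) / - y = y^-1 by rewrite invrN mulrNN mul1r.
  rewrite chV ch1 mulr1 => <-; apply: eq_bigr => l _.
  by congr (_ * ch e _); ring.
by rewrite chD -/(J c e); ring.
Qed.

Let T (k : F) := \sum_w \sum_m
  ch (3 * e) m * ch (9 * e) (1 + 2 * w - m * k) * ch (- (9 * e)) (1 + m * w ^+ 2).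
Let That c := \sum_k ch c k * T k.

(** Unlike [jacobi_linear], this allows [b = 0]: the main term is then 0, and the summand is a
    multiple of [ch (c + d)], whose sum survives only for the trivial character. *)
Lemma sum_mellin_linear c d (a b : F) : a != 0 ->
  \sum_x ch c x * ch d (b - a * x) =
  ch (- c) a * ch (c + d) b * J c d +
  (if (b == 0) && (c + d == 0) then ch d (- a) * (q - 1) else 0).
Proof.
move=> a0; have na : - a != 0 by rewrite oppr_eq0.
have [->|b0] := eqVneq b 0.
  rewrite chz mulr0 mul0r add0r /=.
  under eq_bigr do rewrite sub0r -mulNr chM mulrCA -chD.
  by rewrite -mulr_sumr sum_ch; case: ifP; rewrite ?mulr0.
rewrite addr0; under eq_bigr do rewrite -mulNr.
rewrite jacobi_linear // invrN mulrNN mulrC [ch c (b / a)]chM chV chD; ring.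
Qed.

(** The sums are taken over [k], then [m], then [w]. The exceptional terms come from [w = 0] in the
    sum over [m], felt at [c = 3 * e], and from [w = -1/2] in the sum over [k], felt at
    [c = - (9 * e)]. *)
Lemma ThatE c : That c =
  J c (9 * e) * (sg (3 * e - c) * ch (3 * e - c) 4 * J (3 * e - c) (- (9 * e))
     * J (2 * (c - 3 * e)) (c + 9 * e) + (if c == 3 * e then q - 1 else 0))
  + (if c == - (9 * e) then (q - 1) * (sg (9 * e) * J (12 * e) (- (9 * e))) else 0).
Proof.
have f0 := four_neq0 two0.
pose I (w m : F) := ch (- c) m * ch (c + 9 * e) (1 + 2 * w) * J c (9 * e) +
  (if (1 + 2 * w == 0) && (c + 9 * e == 0) then ch (9 * e) (- m) * (q - 1) else 0).
have -> : That c = \sum_w \sum_m ch (3 * e) m * ch (- (9 * e)) (1 + m * w ^+ 2) * I w m.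
  rewrite /That /T; under eq_bigr do rewrite mulr_sumr.
  rewrite exchange_big; apply: eq_bigr => w _ /=.
  under eq_bigr do rewrite mulr_sumr.
  rewrite exchange_big; apply: eq_bigr => m _ /=.
  have [->|m0] := eqVneq m 0.
    by rewrite !chz !mul0r big1 // => k _; rewrite !mul0r mulr0.
  rewrite /I -sum_mellin_linear // mulr_sumr; apply: eq_bigr => k _; ring.
have -> : \sum_w \sum_m ch (3 * e) m * ch (- (9 * e)) (1 + m * w ^+ 2) * I w m =
  J c (9 * e) * (\sum_w ch (c + 9 * e) (1 + 2 * w) *
     \sum_m ch (3 * e - c) m * ch (- (9 * e)) (1 + w ^+ 2 * m)) +
  \sum_w \sum_m ch (3 * e) m * ch (- (9 * e)) (1 + m * w ^+ 2) *
  (if (1 + 2 * w == 0) && (c + 9 * e == 0) then ch (9 * e) (- m) * (q - 1) else 0).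
  rewrite mulr_sumr -big_split; apply: eq_bigr => w _ /=.
  rewrite !mulr_sumr -big_split; apply: eq_bigr => m _ /=.
  rewrite /I [w ^+ 2 * m]mulrC [ch (3 * e - c) m]chD mulrDr.
  by congr (_ + _); ring.
congr (_ * _ + _).
  rewrite (bigD1 0) //= mulr0 addr0 ch1 mul1r expr0n addrC; congr (_ + _); last first.
    under eq_bigr do rewrite mul0r addr0 ch1 mulr1.
    by rewrite sum_ch subr_eq0 eq_sym.
  transitivity (\sum_(w : F) sg (3 * e - c) * J (3 * e - c) (- (9 * e)) *
    (ch (2 * (c - 3 * e)) w * ch (c + 9 * e) (1 + 2 * w))).
    rewrite [RHS](bigD1 0) //= chz mul0r mulr0 add0r; apply: eq_bigr => w w0.
    rewrite jacobi_linear ?expf_neq0 ?oner_neq0 // ch1 mulr1 mulN1r chN chV -ch_mul2.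
    have -> : 2 * - (3 * e - c) = 2 * (c - 3 * e) by ring.
    by ring.
  rewrite -mulr_sumr jacobi_linear ?oner_neq0 // ch1 mulr1 ch_mul2.
  have -> : (-1 / 2) ^+ 2 = 4^-1 :> F by field; rewrite two0 f0.
  rewrite chV opprB; ring.
have [c9|c9] := eqVneq c (- (9 * e)); last first.
  rewrite big1 // => w _; rewrite big1 // => m _.
  by rewrite [c + _ == 0]addr_eq0 (negPf c9) andbF mulr0.
rewrite c9 addNr eqxx (bigD1 (- 2^-1)) //= [X in _ + X]big1 ?addr0 => [|w w2]; last first.
  rewrite big1 // => m _; rewrite ifN ?mulr0 // andbT.
  apply: contraNN w2 => /eqP w2; rewrite -subr_eq0; apply/eqP/(mulfI two0).
  by rewrite mulr0 -w2; field.
transitivity ((q - 1) * sg (9 * e) * \sum_m ch (12 * e) m * ch (- (9 * e)) (1 + 4^-1 * m)).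
  rewrite mulr_sumr; apply: eq_bigr => m _.
  rewrite ifT; last by rewrite andbT; apply/eqP; field.
  have -> : (- 2^-1) ^+ 2 = 4^-1 :> F by field; rewrite two0 f0.
  have -> : 12 * e = 3 * e + 9 * e by ring.
  by rewrite chN chD [m * _]mulrC; ring.
rewrite jacobi_linear ?oner_neq0 ?invr_eq0 // ch1 mulr1 invrK mulN1r chN.
rewrite [sg (12 * e)]sg_mulr /= mul1r.
have -> : 4 = 2 ^+ 2 :> F by ring.
by rewrite ch_order2_sqr // mul1r mulrA.
Qed.

Lemma jacobi_zero b : b != 0 -> J 0 b = -1.
Proof.
move=> b0; apply: (mulfI q0); rewrite jacobi_gauss ?b0 ?orbT // add0r gauss0.
rewrite mulN1r mulNr gaussK Nm_q // mulrN mulrA sgK; ring.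
Qed.

(** In general, duplication at [c - 3 * e] reduces the three Jacobi sums to four Gauss sums. At
    [c = 3 * e] and [c = - (9 * e)] the exceptional terms of [ThatE] restore the same formula. *)
Lemma That_gauss c : That c * g (12 * e) =
  g c * g (c + 6 * e) * g (c + 9 * e) * g (- (3 * c + 3 * e)).
Proof.
have g12 := gauss_neq0 (12 * e); have g9 := gauss_neq0 (9 * e).
have f0 := four_neq0 two0; have hh := gauss12K.
have h4 : ch (12 * e) 4 = 1.
  have -> : 4 = 2 ^+ 2 :> F by ring.
  by rewrite ch_order2_sqr.
have s0 : sg 0 = 1 by rewrite /sg ch0 // oppr_eq0 oner_eq0.
rewrite ThatE; have [c3|c3] := eqVneq c (3 * e).
  rewrite ifN; last first.
    by rewrite c3 -addr_eq0; have -> : 3 * e + 9 * e = 12 * e by ring.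
  rewrite c3 !subrr mulr0 addr0 ch0 // s0 !mul1r.
  have -> : 3 * e + 9 * e = 12 * e by ring.
  rewrite !jacobi_zero ?oppr_eq0 //.
  rewrite (@jacobi_gauss_inv (3 * e) (9 * e) (12 * e)) ?e3 //; last first.
    by apply: (@index_eq 1); ring.
  have -> : 3 * e + 6 * e = 9 * e by ring.
  have -> : - (3 * (3 * e) + 3 * e) = 12 * e by apply: (@index_eq (-1)); ring.
  by rewrite sg_mulr /=; field.
have [c9|c9] := eqVneq c (- (9 * e)).
  rewrite c9 addNr.
  have -> : 2 * (- (9 * e) - 3 * e) = 0 by apply: (@index_eq (-1)); ring.
  have -> : 3 * e - - (9 * e) = 12 * e by ring.
  have -> : J (- (9 * e)) (9 * e) = - sg (- (9 * e)).
    by have := @jacobi_opp (- (9 * e)); rewrite opprK; apply; rewrite oppr_eq0.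
  rewrite jacobi00 h4.
  rewrite (@jacobi_gauss_inv (12 * e) (- (9 * e)) (- (3 * e))) ?e12 //; last by ring.
  have -> : - (9 * e) + 6 * e = - (3 * e) by ring.
  have -> : - (3 * - (9 * e) + 3 * e) = 0 by apply: (@index_eq 1); ring.
  rewrite gauss0 !sgN !sg_mulr /= -hh.
  by case: (sgP e) => ->; field.
rewrite !addr0.
have c3' : 3 * e - c != 0 by rewrite subr_eq0 eq_sym.
have c3'' : c - 3 * e != 0 by rewrite subr_eq0.
have c9' : c + 9 * e != 0 by rewrite addr_eq0.
rewrite (@jacobi_gauss_inv c (9 * e) (- (c + 9 * e))) ?e9 ?orbT //.
rewrite (@jacobi_gauss_inv (3 * e - c) (- (9 * e)) (c + 6 * e)) ?c3' //; last by ring.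
rewrite (@jacobi_gauss_inv (2 * (c - 3 * e)) (c + 9 * e) (- (3 * c + 3 * e))) ?c9' ?orbT //;
  last by ring.
rewrite (@gaussN_inv (9 * e) (- (9 * e))) // (@gaussN_inv (c + 9 * e) (- (c + 9 * e))) //.
rewrite (@gaussN_inv (c - 3 * e) (3 * e - c)) //; last by ring.
have D := gauss_dup h2 e12 two0 (c - 3 * e).
have cE : c - 3 * e + 12 * e = c + 9 * e by ring.
rewrite cE in D.
have -> : g (2 * (c - 3 * e)) = g (c - 3 * e) * g (c + 9 * e) * ch (c - 3 * e) 4 / g (12 * e).
  by rewrite D mulfK.
have -> : ch (3 * e - c) 4 = (ch (c - 3 * e) 4)^-1.
  apply: (mulfI (ch_neq0 (c - 3 * e) f0)); rewrite divff ?ch_neq0 //.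
  by rewrite -[3 * e - c]opprB chVK.
rewrite !sge /=.
have g3 := gauss_neq0 (c - 3 * e); have gc9 := gauss_neq0 (c + 9 * e).
have k4 := ch_neq0 (c - 3 * e) f0.
by case: (sgP e) => ->; case: (sgP c) => ->; field; rewrite ?g12 ?g9 ?g3 ?gc9 ?k4 ?q0.
Qed.

(** The constant relating the two Mellin transforms; [K_jacobi] evaluates it. *)
Let K := g e * g (11 * e) * g (12 * e) * ch e 27.

Lemma twenty_seven_neq0 : 27 != 0 :> F.
Proof.
have -> : 27 = 3 * 3 * 3 :> F by ring.
by rewrite !mulf_neq0.
Qed.

(** Triplication at [- (c + e)] splits [g (- (3 * c + 3 * e))] into three Gauss sums. Two belong to
    [fhat c]; the third, at [- (c + 9 * e)], pairs with [g (c + 9 * e)] from [That c] to give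
    [Nm (c + 9 * e)]. *)
Lemma fhat_That c : q * fhat c * Nm (c + 9 * e) = K * ch c (- 27) * That c.
Proof.
have t27 := twenty_seven_neq0.
have gn a : g a != 0 := gauss_neq0 a.
rewrite fhatE (@jacobi_gauss_inv (7 * e - c) (11 * e) (c + 6 * e)) ?e11 ?orbT //; last first.
  by apply: (@index_eq 1); ring.
rewrite (@jacobi_gauss_inv c e (- (c + e))) ?e1 ?orbT //.
have -> : Nm (c + 9 * e) = sg (c + 9 * e) * (g (c + 9 * e) * g (- (c + 9 * e))).
  by rewrite gaussK mulrA sgK mul1r.
have H := gauss_triple w3 e8 three0 (- (c + e)).
have E1 : - (c + e) + 8 * e = 7 * e - c by ring.
have E2 : - (c + e) - 8 * e = - (c + 9 * e) by ring.
have E3 : 3 * - (c + e) = - (3 * c + 3 * e) by ring.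
rewrite E1 E2 E3 in H.
have -> : That c = g c * g (c + 6 * e) * g (c + 9 * e) * g (- (3 * c + 3 * e)) / g (12 * e).
  by rewrite -That_gauss mulfK.
have -> : g (- (3 * c + 3 * e)) =
    g (- (c + e)) * g (7 * e - c) * g (- (c + 9 * e)) * ch (- (c + e)) 27 / q.
  by rewrite H mulrAC divff // mul1r.
have a0 := ch_neq0 e t27; have b0 := ch_neq0 c t27.
have -> : ch (- (c + e)) 27 = (ch e 27 * ch c 27)^-1.
  apply: (mulfI (mulf_neq0 a0 b0)); rewrite divff ?mulf_neq0 // -!chD.
  have -> : e + c + - (c + e) = 0 by ring.
  by rewrite ch0.
rewrite /K chN !sge /=.
by case: (sgP e) => ->; case: (sgP c) => ->; field; rewrite ?gn ?a0 ?b0 ?q0.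
Qed.

(** [Nm (c + 9 * e)] is [q] except at [c = - (9 * e)]. The subtracted multiple of [ch (9 * e)],
    whose transform is concentrated at that index, makes up for the exception, and [mellin_inj]
    applies. *)
Lemma period_double_sum l : l != 0 ->
  q * (q * f l - fhat (- (9 * e)) * ch (9 * e) l) = K * T (- l / 27).
Proof.
have t27 := twenty_seven_neq0.
move: l; apply: mellin_inj => c.
have -> : \sum_x ch c x * (K * T (- x / 27)) = K * ch c (- 27) * That c.
  have k0 : -27 != 0 :> F by rewrite oppr_eq0.
  rewrite -(sum_dilate _ k0) /That mulr_sumr; apply: eq_bigr => x _.
  have -> : - (- 27 * x) / 27 = x by field.
  by rewrite chM; ring.
rewrite -fhat_That.
transitivity (q * (q * fhat c - fhat (- (9 * e)) * \sum_x ch (c + 9 * e) x)).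
  rewrite mulrBr !mulr_sumr -sumrB; apply: eq_bigr => x _.
  by rewrite chD; ring.
rewrite sum_ch /Nm; case: eqP => [/eqP|_]; last by ring.
rewrite addr_eq0 => /eqP ->; ring.
Qed.

(** An affine change of variable carries [- b] and [a] to 0 and 1, which reduces the sum to
    [jacobi_opp]. *)
Lemma sum_mobius d (a b : F) : d != 0 -> a + b != 0 ->
  \sum_j ch d (a - j) * ch (- d) (j + b) = - sg d.
Proof.
move=> d0 ab; have := @jacobi_opp (- d); rewrite opprK sgN oppr_eq0 => /(_ d0) <-.
rewrite -(sum_shift (- b)) -(sum_dilate _ ab) /J /jacobi; apply: eq_bigr => t _.
have -> : a - ((a + b) * t - b) = (a + b) * (1 - t) by ring.
have -> : (a + b) * t - b + b = (a + b) * t by ring.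
rewrite !chM; transitivity (ch d (a + b) * ch (- d) (a + b) * (ch (- d) t * ch d (1 - t))).
  by ring.
by rewrite chVK // mul1r.
Qed.

(** * Rational substitutions on the pullback *)

Let D (k : F) := (k - 1) ^+ 2 / k.
(** The inner sum is [H (D k, X)]; [k = 1] is left out because [D 1 = 0] does not allow scaling by
    [D k]. *)
Let S (X : F) := \sum_(k | k != 1) ch (6 * e) k *
  \sum_i ch (3 * e) i * ch (9 * e) (D k - i) * ch (- (9 * e)) (i + X).

Section Pullback.
Variable X : F.
Hypotheses (X0 : X != 0) (X1 : 1 - X != 0) (X2 : 1 + 2 * X != 0).

(** Scaling [w] by [1 / (2 (1 - X))] and [m] by [4 (1 - X) ^ 2] clears the denominators. With the
    prefactor [ch (3 * e) (1 - X)] the powers of [1 - X] cancel, since [3 * (3 * e) = 9 * e]. *)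
Lemma T_scaled : ch (3 * e) (1 - X) * T (X / 4 / (1 - X) ^+ 3) =
  ch (3 * e) 4 * \sum_W \sum_m
    ch (3 * e) m * ch (9 * e) (1 + W - (1 + m) * X) * ch (- (9 * e)) (1 + m * W ^+ 2).
Proof.
have f0 := four_neq0 two0; set u := 1 - X.
have k0 : (2 * u)^-1 != 0 by rewrite invr_eq0 mulf_neq0.
have l0 : 4 * u ^+ 2 != 0 by rewrite mulf_neq0 ?expf_neq0.
rewrite /T -(sum_dilate _ k0) !mulr_sumr; apply: eq_bigr => W _.
rewrite -(sum_dilate _ l0) !mulr_sumr; apply: eq_bigr => m _.
have -> : 1 + 2 * ((2 * u)^-1 * W) - 4 * u ^+ 2 * m * (X / 4 / u ^+ 3) =
  (1 + W - (1 + m) * X) / u.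
  by rewrite -[1 + W - _](_ : u + W - m * X = _); [field; rewrite ?X1 ?two0 ?f0 | rewrite /u; ring].
have -> : 4 * u ^+ 2 * m * ((2 * u)^-1 * W) ^+ 2 = m * W ^+ 2.
  by field; rewrite X1 two0.
rewrite !chM chV.
have U : ch (3 * e) u * ch (3 * e) u * ch (3 * e) u * ch (- (9 * e)) u = 1.
  rewrite -!chD; have -> : 3 * e + 3 * e + 3 * e + - (9 * e) = 0 by ring.
  by rewrite ch0.
rewrite -[RHS]mul1r -[1 in RHS]U; ring.
Qed.

(** For [Y != 0] the substitution [(1 + m) * X = j * Y] turns one side into the other. For [Y = 0]
    both sides are computed, and [sum_mobius] asks for [1 + 2 * X != 0], which is the condition
    [x != -1/8]. *)
Lemma pullback_fiber Y :
  \sum_m ch (3 * e) m * ch (9 * e) (Y - (1 + m) * X) * ch (- (9 * e)) (1 + m * (Y - 1) ^+ 2) =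
  ch (6 * e) X * \sum_j ch (3 * e) (j * Y - X) * ch (9 * e) (1 - j) *
    ch (- (9 * e)) (X * (2 - Y) + j * (Y - 1) ^+ 2).
Proof.
have E9 : ch (6 * e) X * ch (3 * e) X = ch (9 * e) X.
  by rewrite -chD; congr (ch _ X); ring.
have [->|Y0] := eqVneq Y 0.
  transitivity (- (ch (9 * e) (- X) * sg (3 * e))).
    transitivity (ch (9 * e) (- X) * \sum_(m | m != -1) ch (3 * e) m).
      rewrite mulr_sumr (bigD1 (-1)) //= subrr mul0r subrr chz mulr0 mul0r add0r.
      apply: eq_bigr => m m1; have m0 : 1 + m != 0 by rewrite addrC -[1]opprK subr_eq0.
      have -> : 0 - (1 + m) * X = - X * (1 + m) by ring.
      have -> : 1 + m * (0 - 1) ^+ 2 = 1 + m by ring.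
      rewrite chM; transitivity (ch (9 * e) (- X) * ch (3 * e) m *
        (ch (9 * e) (1 + m) * ch (- (9 * e)) (1 + m))); first by ring.
      by rewrite chVK // mulr1.
    have := sum_ch (3 * e); rewrite (negPf e3) (bigD1 (-1)) //= => /eqP.
    by rewrite addrC addr_eq0 => /eqP ->; rewrite mulrN.
  transitivity (ch (6 * e) X * (ch (3 * e) (- X) *
     \sum_j ch (9 * e) (1 - j) * ch (- (9 * e)) (j + 2 * X))).
    rewrite sum_mobius // !chN -E9 !sg_mulr /=; ring.
  congr (_ * _); rewrite mulr_sumr; apply: eq_bigr => j _.
  have -> : j * 0 - X = - X by ring.
  have -> : X * (2 - 0) + j * (0 - 1) ^+ 2 = j + 2 * X by ring.
  by ring.
have k0 : Y / X != 0 by rewrite mulf_neq0 ?invr_eq0.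
rewrite -(sum_shift (-1)) -(sum_dilate _ k0) mulr_sumr; apply: eq_bigr => j _.
have -> : Y / X * j - 1 = (j * Y - X) / X by field.
have -> : Y - (1 + (j * Y - X) / X) * X = Y * (1 - j) by field.
have -> : 1 + (j * Y - X) / X * (Y - 1) ^+ 2 =
  Y / X * (X * (2 - Y) + j * (Y - 1) ^+ 2) by field.
rewrite !chM !chV opprK.
have EX : ch (- (3 * e)) X * ch (9 * e) X = ch (6 * e) X.
  by rewrite -chD; congr (ch _ X); ring.
transitivity (ch (9 * e) Y * ch (- (9 * e)) Y * (ch (- (3 * e)) X * ch (9 * e) X) *
  (ch (3 * e) (j * Y - X) * ch (9 * e) (1 - j) *
   ch (- (9 * e)) (X * (2 - Y) + j * (Y - 1) ^+ 2))); first by ring.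
by rewrite chVK // mul1r EX.
Qed.

Lemma T_pullback : ch (3 * e) (1 - X) * T (X / 4 / (1 - X) ^+ 3) =
  ch (3 * e) 4 * (ch (6 * e) X * S X + ch (- (3 * e)) X * J (3 * e) (9 * e)).
Proof.
rewrite T_scaled; congr (_ * _).
rewrite -(sum_shift (-1)).
transitivity (\sum_Y ch (6 * e) X * \sum_j ch (3 * e) (j * Y - X) * ch (9 * e) (1 - j) *
    ch (- (9 * e)) (X * (2 - Y) + j * (Y - 1) ^+ 2)).
  apply: eq_bigr => Y _; rewrite -pullback_fiber; apply: eq_bigr => m _.
  by have -> : 1 + (Y - 1) = Y by ring.
rewrite -mulr_sumr exchange_big /=.
transitivity (ch (6 * e) X * \sum_j \sum_k ch (3 * e) j * ch (9 * e) (1 - j) *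
   (ch (3 * e) k * ch (- (9 * e)) (j * (k - 1) ^+ 2 + X * k))).
  congr (_ * _); apply: eq_bigr => j _.
  (* No shift by [X / j] is available at [j = 0], but both inner sums vanish, the left one as a
     complete sum of a nontrivial character. *)
  have [->|j0] := eqVneq j 0.
    rewrite [RHS]big1 => [|k _]; last by rewrite chz !mul0r.
    transitivity (ch (3 * e) (- X) * \sum_Y ch (- (9 * e)) (X * (2 - Y))).
      rewrite mulr_sumr; apply: eq_bigr => Y _.
      by rewrite !mul0r sub0r subr0 addr0 ch1 mulr1.
    rewrite (sum_reflect 2 (fun y => ch (- (9 * e)) (X * y))).
    by rewrite (sum_dilate (ch (- (9 * e))) X0) sum_ch oppr_eq0 (negPf e9) mulr0.
  (* The shift [Y = k + X / j] turns [j * Y - X] into [j * k]; after exchanging the sums, [j] can be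
     scaled by [D k]. *)
  rewrite -(sum_shift (X / j)); apply: eq_bigr => k _.
  have -> : j * (k + X / j) - X = j * k by field.
  have -> : X * (2 - (k + X / j)) + j * (k + X / j - 1) ^+ 2 =
     j * (k - 1) ^+ 2 + X * k by field.
  by rewrite chM; ring.
rewrite exchange_big /= (bigD1 1) //= addrC mulrDr; congr (_ + _); last first.
  have EX : ch (6 * e) X * ch (- (9 * e)) X = ch (- (3 * e)) X.
    by rewrite -chD; congr (ch _ X); ring.
  rewrite -EX -mulrA; congr (_ * _); rewrite /J /jacobi mulr_sumr; apply: eq_bigr => j _.
  have -> : j * (1 - 1) ^+ 2 + X * 1 = X by ring.
  by rewrite ch1; ring.
congr (_ * _); apply: eq_bigr => k k1.
have [->|k0] := eqVneq k 0.
  by rewrite !chz mul0r big1 // => j _; rewrite mul0r mulr0.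
have k10 : k - 1 != 0 by rewrite subr_eq0.
have D0 : D k != 0 by rewrite /D mulf_neq0 ?invr_eq0 ?expf_neq0.
rewrite -(sum_dilate _ (_ : (D k)^-1 != 0)) ?invr_eq0 // mulr_sumr; apply: eq_bigr => i _.
have -> : 1 - (D k)^-1 * i = (D k)^-1 * (D k - i) by field.
have -> : (D k)^-1 * i * (k - 1) ^+ 2 + X * k = k * (i + X).
  by rewrite /D; field; rewrite k0 k10.
have DE : ch (- (3 * e)) (D k) * ch (- (9 * e)) (D k) = ch (12 * e) k.
  rewrite -chD; have -> : - (3 * e) - 9 * e = 12 * e by apply: (@index_eq (-1)); ring.
  rewrite /D chM ch_order2_sqr // mul1r chV; congr (ch _ k).
  by apply: (@index_eq (-1)); ring.
have kE : ch (6 * e) k = ch (12 * e) k * ch (3 * e) k * ch (- (9 * e)) k.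
  by rewrite -!chD; congr (ch _ k); ring.
rewrite kE -DE; move: (D k) => d; rewrite !chM !chV; ring.
Qed.
End Pullback.

(** * The Mellin transform of [S] and the sum over roots *)

Lemma Shat c : \sum_X ch c X * S X =
  sg c * J c (- (9 * e)) * J (c - 6 * e) (9 * e) * J (3 * e - c) (2 * c + 6 * e).
Proof.
rewrite /S; under eq_bigr do rewrite mulr_sumr.
rewrite exchange_big /= /J {3}/jacobi mulr_sumr [RHS](bigD1 1) //= subrr chz !mulr0 add0r.
apply: eq_bigr => k k1; have [->|k0] := eqVneq k 0.
  by rewrite !chz !mul0r mulr0 big1 // => i _; rewrite mul0r mulr0.
have k10 : k - 1 != 0 by rewrite subr_eq0.
have D0 : D k != 0 by rewrite /D mulf_neq0 ?invr_eq0 ?expf_neq0.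
transitivity (ch (6 * e) k * \sum_i ch (3 * e) i * ch (9 * e) (D k - i) *
   \sum_X ch c X * ch (- (9 * e)) (i + X)).
  under eq_bigr do rewrite mulrCA.
  rewrite -mulr_sumr; congr (_ * _).
  under eq_bigr do rewrite mulr_sumr.
  rewrite exchange_big; apply: eq_bigr => i _ /=.
  rewrite mulr_sumr; apply: eq_bigr => x _; ring.
transitivity (ch (6 * e) k * (sg c * J c (- (9 * e)) *
  \sum_i ch (c - 6 * e) i * ch (9 * e) (D k + -1 * i))).
  congr (_ * _); rewrite mulr_sumr; apply: eq_bigr => i _.
  have [->|i0] := eqVneq i 0; first by rewrite !chz !mul0r mulr0.
  under eq_bigr do rewrite -[X in i + X]mul1r.
  rewrite jacobi_linear ?oner_neq0 // divr1 chN mulN1r.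
  have -> : c - 6 * e = c - 9 * e + 3 * e by ring.
  by rewrite !chD -/(J _ _); ring.
rewrite jacobi_linear ?oppr_eq0 ?oner_neq0 // invrN invr1 mulrNN mulr1.
have -> : 1 - k = - (k - 1) by ring.
have E1 : ch (c - 6 * e) (D k) * ch (9 * e) (D k) =
    ch (2 * c + 6 * e) (k - 1) * ch (- (c + 3 * e)) k.
  rewrite -chD; have -> : c - 6 * e + 9 * e = c + 3 * e by ring.
  have -> : 2 * c + 6 * e = 2 * (c + 3 * e) by ring.
  by rewrite /D chM chV ch_mul2.
rewrite E1 -/(J c (- (9 * e))) -/(J (c - 6 * e) (9 * e)).
have -> : 3 * e - c = 6 * e - (c + 3 * e) by ring.
rewrite chN !sge /= [ch (6 * e - (c + 3 * e)) k]chD; ring.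
Qed.

(** The Mellin transform of [ch (- (6 * e)) X * Gam X], see [sum_Gam]. *)
Let Ghat c := ch (c - 6 * e) 16 * J c (c - 6 * e).

(** Duplication at [- (c + 3 * e)] and [- (c + 9 * e)] matches the Gauss sums of both sides; the
    values at 4 that it brings in are absorbed by [ch (c - 6 * e) 16]. *)
Lemma Shat_gauss c : \sum_X ch c X * S X = Nm (2 * c + 6 * e) * Ghat c.
Proof.
have f0 := four_neq0 two0.
have gn a : g a != 0 := gauss_neq0 a.
rewrite Shat /Ghat.
rewrite (@jacobi_gauss_inv c (- (9 * e)) (9 * e - c)) ?oppr_eq0 ?e9 ?orbT //; last by ring.
rewrite (@jacobi_gauss_inv (c - 6 * e) (9 * e) (- (c + 3 * e))) ?e9 ?orbT //; last by ring.
have N1 : (3 * e - c != 0) || (2 * c + 6 * e != 0).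
  rewrite subr_eq0; have [<-|//] := eqVneq (3 * e) c.
  by have -> : 2 * (3 * e) + 6 * e = 12 * e by ring.
have N2 : (c != 0) || (c - 6 * e != 0).
  by have [->|//] := eqVneq c 0; rewrite sub0r oppr_eq0 e6.
rewrite (@jacobi_gauss_inv (3 * e - c) (2 * c + 6 * e) (- (c + 9 * e))) //; last by ring.
rewrite (@jacobi_gauss_inv c (c - 6 * e) (- (2 * c - 6 * e))) //; last by ring.
have D1 := gauss_dup h2 e12 two0 (- (c + 3 * e)).
have D2 := gauss_dup h2 e12 two0 (- (c + 9 * e)).
have E1 : - (c + 3 * e) + 12 * e = 9 * e - c by ring.
have E2 : - (c + 9 * e) + 12 * e = 3 * e - c by ring.
have E3 : 2 * - (c + 3 * e) = - (2 * c + 6 * e) by ring.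
have E4 : 2 * - (c + 9 * e) = - (2 * c - 6 * e) by apply: (@index_eq (-1)); ring.
rewrite E1 E3 in D1; rewrite E2 E4 in D2.
have -> : Nm (2 * c + 6 * e) = g (2 * c + 6 * e) * g (- (2 * c + 6 * e)).
  by rewrite gaussK !sge /= mul1r mul1r.
have k1 := ch_neq0 (- (c + 3 * e)) f0; have k2 := ch_neq0 (- (c + 9 * e)) f0.
have -> : g (- (2 * c + 6 * e)) =
   g (- (c + 3 * e)) * g (9 * e - c) * ch (- (c + 3 * e)) 4 / g (12 * e).
  by rewrite D1 mulfK.
have -> : g (- (2 * c - 6 * e)) =
   g (- (c + 9 * e)) * g (3 * e - c) * ch (- (c + 9 * e)) 4 / g (12 * e).
  by rewrite D2 mulfK.
have K4 : ch (- (c + 3 * e)) 4 * ch (- (c + 9 * e)) 4 * ch (c - 6 * e) 16 = 1.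
  have -> : 16 = 4 ^+ 2 :> F by ring.
  rewrite -ch_mul2 -!chD.
  have -> : - (c + 3 * e) + - (c + 9 * e) + 2 * (c - 6 * e) = 0 by apply: (@index_eq (-1)); ring.
  by rewrite ch0.
rewrite (@gaussN_inv (9 * e) (- (9 * e))) //.
have -> : ch (c - 6 * e) 16 = (ch (- (c + 3 * e)) 4 * ch (- (c + 9 * e)) 4)^-1.
  by apply: (mulfI (mulf_neq0 k1 k2)); rewrite K4 divff ?mulf_neq0.
rewrite !sge /= -gauss12K.
by case: (sgP e) => ->; case: (sgP c) => ->; field; rewrite ?gn ?k1 ?k2.
Qed.

(* An 8th root of unity [z] exists, and [(z + z^-1) ^ 2 = 2]. *)
Lemma ch12_two : ch (12 * e) 2 = 1.
Proof.
have N1 : -1 != 0 :> F by rewrite oppr_eq0 oner_eq0.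
case: (cf_gen chF N1) => i iE.
have i2 : (2 * i)%N%:R * e = 0.
  apply: (cf_inj chF); rewrite ch_mulr ?(cf_gam chF) // -chX mulnC exprM -iE.
  by rewrite sqrrN expr1n ch1.
have i4 : (i %% 4)%:R * (6 * e) = 0.
  have -> : (i %% 4)%:R * (6 * e) = 3 * ((2 * i)%N%:R * e) - (i %/ 4)%:R * (24 * e).
    have iE4 : i%:R = (i %/ 4)%:R * 4 + (i %% 4)%:R :> R.
      by rewrite {1}(divn_eq i 4) natrD natrM.
    by rewrite natrM iE4; ring.
  by rewrite i2 e24 !mulr0 subrr.
have {i4} i4 : (i %% 4 = 0)%N.
  move: i4; have := ltn_pmod i (isT : 0 < 4)%N; case: (i %% 4)%N => [|[|[|[|//]]]] // _ H.
  - by have := e6; rewrite -[6 * e]mul1r H eqxx.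
  - by have := e12; have -> : 12 * e = 2 * (6 * e) by [ring]; rewrite H eqxx.
  - have e18 : 3 * (6 * e) != 0 by apply: (@index_neq0 2 1); ring.
    by rewrite H eqxx in e18.
pose z := gam ^+ (i %/ 4).
have z4 : z ^+ 4 = -1 by rewrite /z -exprM iE [in RHS](divn_eq i 4) i4 addn0.
have z0 : z != 0 by rewrite expf_neq0 // (cf_gam chF).
have E : 2 = (z + z^-1) ^+ 2 :> F.
  have -> : (z + z^-1) ^+ 2 = 2 + (z ^+ 4 + 1) / z ^+ 2 by field.
  by rewrite z4 addNr mul0r addr0.
rewrite {1}E ch_order2_sqr //; apply: contraNneq two0 => zz.
by rewrite E zz expr0n.
Qed.

Lemma jacobiC a b : J a b = J b a.
Proof.
rewrite /J /jacobi -(sum_reflect 1); apply: eq_bigr => x _.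
by rewrite mulrC opprB addrC subrK.
Qed.

Let Gam (X : F) := \sum_(U : F | 16 * U * (1 - U) == X) ch (6 * e) U.

Lemma sum_Gam c : \sum_X ch c X * (ch (- (6 * e)) X * Gam X) = Ghat c.
Proof.
rewrite /Ghat /J /jacobi mulr_sumr.
rewrite [RHS](partition_big (fun U => 16 * U * (1 - U)) predT) //; apply: eq_bigr => X _.
rewrite /Gam !mulr_sumr; apply: eq_bigr => U /= /eqP <-.
have -> : ch c U = ch (c - 6 * e) U * ch (6 * e) U by rewrite -chD subrK.
by rewrite mulrA -chD !chM; ring.
Qed.

(** [Nm (2 * c + 6 * e)] differs from [q] only at [c = - (3 * e)] and [c = 9 * e]; each subtracted
    character has its transform at just one of them, where it lowers [q] to 1. *)
Lemma S_eval X : X != 0 -> S X = q * (ch (- (6 * e)) X * Gam X)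
  - Ghat (- (3 * e)) * ch (3 * e) X - Ghat (9 * e) * ch (- (9 * e)) X.
Proof.
move: X; apply: mellin_inj => c; rewrite Shat_gauss.
transitivity (q * Ghat c - Ghat (- (3 * e)) * (\sum_X ch (c + 3 * e) X)
   - Ghat (9 * e) * (\sum_X ch (c - 9 * e) X)); last first.
  rewrite -sum_Gam !mulr_sumr -!sumrB; apply: eq_bigr => X _.
  by rewrite !chD; ring.
rewrite !sum_ch /Nm.
have [c3|c3] := eqVneq (c + 3 * e) 0.
  have cE : c = - (3 * e) by apply/eqP; rewrite -addr_eq0 c3.
  have -> : 2 * c + 6 * e = 0 by rewrite cE; ring.
  rewrite eqxx ifN; last first.
    by rewrite cE -opprD oppr_eq0; have -> : 3 * e + 9 * e = 12 * e by ring.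
  by rewrite cE; ring.
have [c9|c9] := eqVneq (c - 9 * e) 0.
  have cE : c = 9 * e by apply/eqP; rewrite -subr_eq0 c9.
  have -> : 2 * c + 6 * e = 0 by rewrite cE; apply: (@index_eq 1); ring.
  by rewrite eqxx cE; ring.
rewrite ifN; first by ring.
apply/eqP=> c6; have : 2 * (c + 3 * e) = 0 by rewrite -c6; ring.
move/(index_order2 h2 e12); case=> cE; first by rewrite cE eqxx in c3.
by move/eqP: c9; apply; rewrite -[c](addrK (3 * e)) cE; ring.
Qed.

(** The correction of [S_eval] at [9 * e] cancels the [k = 1] term of [T_pullback]; the one at
    [- (3 * e)] remains. The character values at 16 reduce to the quadratic character at 2, which is
    1. *)
Lemma T_eval X : X != 0 -> 1 - X != 0 -> 1 + 2 * X != 0 ->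
  ch (3 * e) (1 - X) * T (X / 4 / (1 - X) ^+ 3) =
  ch (3 * e) 4 * (q * Gam X - J (- (3 * e)) (- (9 * e)) * ch (9 * e) X).
Proof.
move=> X0 X1 X2; rewrite T_pullback // S_eval //; congr (_ * _).
have ch16 a : 4 * a = 12 * e -> ch a 16 = 1.
  move=> aE; have -> : 16 = 2 ^+ 4 :> F by ring.
  by rewrite chX -ch_mulr // aE ch12_two.
have G1 : Ghat (- (3 * e)) = J (- (3 * e)) (- (9 * e)).
  rewrite /Ghat ch16 ?mul1r; last by apply: (@index_eq (-2)); ring.
  by congr (J _ _); ring.
have G2 : Ghat (9 * e) = J (3 * e) (9 * e).
  rewrite /Ghat ch16 ?mul1r; last by ring.
  by rewrite jacobiC; congr (J _ _); ring.
have E1 : ch (6 * e) X * ch (- (6 * e)) X = 1 by rewrite chVK.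
have E2 : ch (9 * e) X = ch (6 * e) X * ch (3 * e) X.
  by rewrite -chD; congr (ch _ X); ring.
have E3 : ch (- (3 * e)) X = ch (6 * e) X * ch (- (9 * e)) X.
  by rewrite -chD; congr (ch _ X); ring.
rewrite G1 G2 E2 E3 -[q * Gam X]mul1r -E1; ring.
Qed.

(** Triplication at [e] and duplication at [3 * e] turn the factor [g (6 * e)] of the Jacobi sum
    into factors of [K]; [g (7 * e)] and [g (9 * e)] cancel. *)
Lemma K_jacobi : K * ch (3 * e) 4 = q * J (7 * e) (11 * e).
Proof.
have gn a : g a != 0 := gauss_neq0 a.
have f0 := four_neq0 two0; have t27 := twenty_seven_neq0.
rewrite (@jacobi_gauss_inv (7 * e) (11 * e) (6 * e)) ?e7 //; last first.
  by apply: (@index_eq 1); ring.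
have H3 := gauss_triple w3 e8 three0 e.
have E1 : e + 8 * e = 9 * e by ring.
have E2 : e - 8 * e = - (7 * e) by ring.
rewrite E1 E2 (@gaussN_inv (7 * e) (- (7 * e))) // in H3.
have H2 := gauss_dup h2 e12 two0 (3 * e).
have E3 : 3 * e + 12 * e = - (9 * e) by apply: (@index_eq 1); ring.
have E4 : 2 * (3 * e) = 6 * e by ring.
rewrite E3 E4 (@gaussN_inv (9 * e) (- (9 * e))) // in H2.
have k4 := ch_neq0 (3 * e) f0.
have h12 := gauss12K.
have -> : g (6 * e) = g (3 * e) * (sg (9 * e) * q / g (9 * e)) * ch (3 * e) 4 / g (12 * e).
  by rewrite H2 mulfK.
have -> : g (3 * e) = g e * g (9 * e) * (sg (7 * e) * q / g (7 * e)) * ch e 27 / q.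
  by rewrite H3 mulrAC divff ?mul1r.
rewrite /K !sg_mulr /= -h12.
by case: (sgP e) => ->; field; rewrite ?gn.
Qed.

(** Both [period_double_sum] and [T_eval] contribute a multiple of
    [That (- (9 * e)) * ch (9 * e) x]. These cancel because [ch (3 * e) 4 * ch (9 * e) 4] is the
    quadratic character at 4, hence 1. *)
Lemma period_pullback x : x != 0 -> 1 - 4 * x != 0 -> 1 + 8 * x != 0 ->
  ch (3 * e) (1 - 4 * x) * f (- 27 * x / (1 - 4 * x) ^+ 3) =
  J (7 * e) (11 * e) * Gam (4 * x).
Proof.
move=> x0 x1 x2; have f0 := four_neq0 two0; have t27 := twenty_seven_neq0.
have gn a : g a != 0 := gauss_neq0 a.
have X0 : 4 * x != 0 by rewrite mulf_neq0.
have X2 : 1 + 2 * (4 * x) != 0 by have -> : 1 + 2 * (4 * x) = 1 + 8 * x by ring.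
set l := - 27 * x / _; set u := 1 - 4 * x in x1 l *.
have l0 : l != 0 by rewrite /l !mulf_neq0 ?invr_eq0 ?expf_neq0 ?oppr_eq0.
have P := period_double_sum l0.
have lE : - l / 27 = 4 * x / 4 / u ^+ 3 by rewrite /l; field; rewrite ?x1 ?f0 ?t27.
have TE := T_eval X0 x1 X2.
rewrite -/u -lE in TE.
have chl : ch (3 * e) u * ch (9 * e) l = ch (9 * e) (- 27) * ch (9 * e) x.
  rewrite /l 2!chM chV chX -ch_mulr //.
  transitivity (ch (9 * e) (- 27) * ch (9 * e) x * (ch (3 * - (9 * e)) u * ch (3 * e) u)).
    by ring.
  rewrite -chD; have -> : 3 * - (9 * e) + 3 * e = 0 by apply: (@index_eq (-1)); ring.
  by rewrite ch0 ?mulr1.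
have FT := fhat_That (- (9 * e)).
have TG := That_gauss (- (9 * e)).
have E1 : - (9 * e) + 6 * e = - (3 * e) by ring.
have E2 : - (3 * - (9 * e) + 3 * e) = 0 by apply: (@index_eq 1); ring.
rewrite addNr /Nm eqxx mulr1 in FT.
rewrite addNr E1 E2 gauss0 in TG.
have JE : J (- (3 * e)) (- (9 * e)) = That (- (9 * e)).
  apply: (mulIf (gn (12 * e))); rewrite TG.
  rewrite (@jacobi_gauss_inv (- (3 * e)) (- (9 * e)) (12 * e)) ?oppr_eq0 ?e3 //; last by ring.
  by rewrite sg_mulr /= -gauss12K; field; rewrite gn.
have k9 : ch (- (9 * e)) (- 27) * ch (9 * e) (- 27) = 1.
  by rewrite mulrC chVK // oppr_eq0.
have k12 : ch (3 * e) 4 * ch (9 * e) 4 = 1.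
  rewrite -chD; have -> : 3 * e + 9 * e = 12 * e by ring.
  have -> : 4 = 2 ^+ 2 :> F by ring.
  by rewrite ch_order2_sqr.
apply: (mulfI (mulf_neq0 q0 q0)).
transitivity (ch (3 * e) u * (q * (q * f l - fhat (- (9 * e)) * ch (9 * e) l)) +
   q * fhat (- (9 * e)) * (ch (3 * e) u * ch (9 * e) l)); first by ring.
rewrite P FT chl.
transitivity (K * (ch (3 * e) u * T (- l / 27)) +
  K * That (- (9 * e)) * ch (9 * e) x * (ch (- (9 * e)) (- 27) * ch (9 * e) (- 27))).
  by ring.
rewrite TE k9 JE [ch (9 * e) (4 * x)]chM.
transitivity (K * ch (3 * e) 4 * q * Gam (4 * x) + K * That (- (9 * e)) * ch (9 * e) x *
  (1 - ch (3 * e) 4 * ch (9 * e) 4)); first by ring.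
by rewrite k12 K_jacobi; ring.
Qed.

Lemma jacobi_neq0 : J (7 * e) (11 * e) != 0.
Proof.
rewrite (@jacobi_gauss_inv (7 * e) (11 * e) (- (7 * e + 11 * e))) ?e7 //.
by rewrite !mulf_neq0 ?gauss_neq0 ?sg_neq0 ?invr_eq0.
Qed.
End Octahedral.
End CharacterSums.

(** * Characters of a finite field *)

Lemma exists_additive_character (F : finFieldType) : exists psi : F -> algC,
  [/\ forall x y, psi (x + y) = psi x * psi y, psi 0 = 1 & exists x, psi x != 1].
Proof.
have abG : abelian [set: F] := FinRing.zmod_abelian [set: F]%G.
have linG i : 'chi[[set: F]%G]_i \is a linear_char by apply/char_abelianP: i.
have : (1 < #|Iirr [set: F]|)%N.
  by rewrite (card_Iirr_abelian abG) cardsT finNzRing_gt1.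
rewrite (cardD1 0) inE => /card_gt0P [i]; rewrite !inE andbT => i0.
exists 'chi_i; split=> [x y||]; first by apply: (lin_charM (linG i)); rewrite inE.
  exact: (lin_char1 (linG i)).
apply/existsP; apply: contraNT i0; rewrite negb_exists => /forallP i1.
rewrite -irr_eq1; apply/eqP/cfunP => x; rewrite cfun1E inE.
by apply/eqP; have := i1 x; rewrite negbK.
Qed.

Lemma exists_field_generator (F : finFieldType) :
  exists gam : F, #|F|.-1.-primitive_root gam.
Proof.
have n0 : (0 < #|F|.-1)%N by rewrite -ltnS prednK ?finNzRing_gt1 // (ltn_trans _ (finNzRing_gt1 F)).
have : has #|F|.-1.-primitive_root (enum (predC1 (0 : F))).
  apply: has_prim_root => //; first 1 last.
  - exact: enum_uniq.
  - by rewrite -cardE cardC1.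
  apply/allP => x; rewrite mem_enum inE => x0; apply/unity_rootP.
  apply: (mulfI x0); rewrite -exprS prednK ?expf_card ?mulr1 //.
  by rewrite (ltn_trans _ (finNzRing_gt1 F)).
by case/hasP=> gam _ pg; exists gam.
Qed.

(** A character is fixed by its value at a generator, an [n]-th root of unity for [n = #|F|.-1], so
    ['Z_n] indexes the characters through the discrete logarithm [dl]. The bound [1 < n] ensures
    that ['Z_n] has exactly [n] elements. *)
Lemma exists_char_family (F : finFieldType) : (1 < #|F|.-1)%N ->
  exists (R : finComNzRingType) (ch : R -> F -> algC) (gam : F),
  char_family ch gam /\
  forall chi, is_mchar chi -> exists c, forall x, chi x = ch c x.
Proof.
move=> n1; case: (exists_field_generator F) => gam pg.
have n0 := ltnW n1; case: (C_prim_root_exists n0) => z pz.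
set n := #|F|.-1 in n1 n0 pg pz.
have g0 : gam != 0.
  apply/eqP => gz; have /eqP := prim_expr_order pg.
  by rewrite gz expr0n -[n == 0%N]negbK -lt0n n0 eq_sym oner_eq0.
have gen (x : F) : x != 0 -> {i : 'I_n | x = gam ^+ i}.
  move=> x0; apply: (prim_rootP pg); apply: (mulfI x0).
  by rewrite -exprS prednK ?expf_card ?mulr1 // (ltn_trans _ (finNzRing_gt1 F)).
pose dl (x : F) := if [pick i : 'I_n | gam ^+ i == x] is Some i then val i else 0%N.
have dlK (x : F) : x != 0 -> gam ^+ dl x = x.
  move=> x0; rewrite /dl; case: pickP => [i /eqP //|no].
  by case: (gen x x0) => i iE; have := no i; rewrite -iE eqxx.
pose ch (c : 'Z_n) (x : F) : algC := if x == 0 then 0 else z ^+ (c * dl x).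
have chX (c : 'Z_n) k : ch c (gam ^+ k) = z ^+ (c * k).
  have k0 : gam ^+ k != 0 by rewrite expf_neq0.
  rewrite /ch (negPf k0); apply/eqP; rewrite (eq_prim_root_expr pz).
  have : gam ^+ dl (gam ^+ k) == gam ^+ k by rewrite dlK.
  by rewrite (eq_prim_root_expr pg) => /eqP E; rewrite -modnMmr E modnMmr.
have Zn a : (a %% (Zp_trunc n).+2 = a %% n)%N by rewrite Zp_cast.
have Zlt (c : 'Z_n) : (c < n)%N := leq_trans (ltn_ord c) (eq_leq (Zp_cast n1)).
exists 'Z_n, ch, gam; split; first split.
- by move=> c; rewrite /ch eqxx.
- move=> c x y; have [->|x0] := eqVneq x 0; first by rewrite mul0r /ch eqxx mul0r.
  have [->|y0] := eqVneq y 0; first by rewrite mulr0 /ch eqxx mulr0.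
  by rewrite -(dlK x x0) -(dlK y y0) -exprD !chX mulnDr exprD.
- move=> c d x; have [->|x0] := eqVneq x 0; first by rewrite /ch eqxx mul0r.
  rewrite -(dlK x x0) !chX -exprD -mulnDl; apply/eqP; rewrite (eq_prim_root_expr pz).
  by rewrite /= Zn modnMml.
- by move=> x x0; rewrite -(dlK x x0) chX mul0n.
- exact: g0.
- by move=> x x0; case: (gen x x0) => i ->; exists i.
- move=> c; rewrite -{1}[gam]expr1 chX muln1 => /eqP.
  rewrite -(prim_order_dvd pz) => nc; apply: val_inj => /=.
  by apply/eqP; rewrite -[nat_of_ord c](modn_small (Zlt c)).
- move=> x x0 x1; exists 1; apply: contra_neq x1.
  rewrite -(dlK x x0) chX /= => /eqP.
  rewrite Zn modn_small // mul1n -(prim_order_dvd pz) (prim_order_dvd pg).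
  by move/eqP.
move=> chi [chi0 chi1 chiM].
have chiX k : chi (gam ^+ k) = chi gam ^+ k.
  elim: k => [|k IH]; first by rewrite !expr0.
  by rewrite !exprS chiM ?expf_neq0 // IH.
have : chi gam ^+ n = 1 by rewrite -chiX (prim_expr_order pg).
case/(prim_rootP pz) => j jE; exists (inZp j) => x.
have [->|x0] := eqVneq x 0; first by rewrite chi0 /ch eqxx.
rewrite -(dlK x x0) chiX chX jE -exprM; apply/eqP; rewrite (eq_prim_root_expr pz) /=.
by rewrite Zn modnMml.
Qed.

(** * Evaluation of the normalized hypergeometric function *)

Theorem mainTheorem14 (F : finFieldType) (eta : F -> algC)
  (hq : (#|F| %% 24 = 1)%N)
  (heta : is_mchar eta) (hord : mchar_order eta 24)
  (x : F) (hx1 : x != - (8%:R)^-1) (hx2 : x != (4%:R)^-1) :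
  let lhs := hyp21 (mchar_conj eta) (mchar_pow eta 7) (mchar_pow eta 18)
               (- 27%:R * x / (1 - 4%:R * x) ^+ 3) in
  (forall s : F, s ^+ 2 = 1 - x ->
     lhs = (1 + qchar (1 - x)) / 2%:R *
           (mchar_pow eta 3 ((1 + s) ^+ 2 / (4%:R * (1 - 4%:R * x)))
            + mchar_pow eta 3 ((1 - s) ^+ 2 / (4%:R * (1 - 4%:R * x)))))
  /\ ((forall s : F, s ^+ 2 != 1 - x) -> lhs = 0).
Proof.
have cardF0 : #|F|%:R = 0 :> F.
  apply: (addrI (\sum_(y : F) y)); rewrite addr0 -[in RHS](sum_shift 1) big_split /=.
  by rewrite sumr_const.
(* If a divisor [m] of 24 vanished in [F], then [#|F| = 24 k + 1] would give [0 = 1] there. *)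
have m0 (m : nat) : (m %| 24)%N -> (1 < m)%N -> m%:R != 0 :> F.
  move=> m24 m1; apply/eqP => mz; have /eqP := cardF0.
  rewrite (divn_eq #|F| 24) hq natrD natrM -(divnK m24) natrM mz !mulr0 add0r.
  by rewrite oner_eq0.
have two0 : 2 != 0 :> F := m0 2%N isT isT.
have three0 : 3 != 0 :> F := m0 3%N isT isT.
have f0 : 4 != 0 :> F := m0 4%N isT isT.
have eight0 : 8 != 0 :> F := m0 8%N isT isT.
have cardn : (1 < #|F|.-1)%N.
  case: #|F| (finNzRing_gt1 F) hq => [|[|[|n]]] //=.
case: (exists_char_family cardn) => R [ch [gam [chF chE]]].
case: (exists_additive_character F) => psi [psiD psi0 psi1].
case: (chE eta heta) => e etaE.
case: hord => _ ord24 ordm.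
have e24 : 24 * e = 0.
  by apply: (cf_inj chF); rewrite (ch_mulr chF) ?(cf_gam chF) // -etaE ord24 // (cf_gam chF).
have em (m : nat) : (0 < m < 24)%N -> m%:R * e != 0.
  move=> /ordm [y y0]; apply: contra_neq => me.
  by rewrite etaE -(ch_mulr chF) // me (cf_0 chF).
have e12 : 12 * e != 0 := em 12%N isT; have e8 : 8 * e != 0 := em 8%N isT.
have powE m (y : F) : (0 < m)%N -> mchar_pow eta m y = ch (m%:R * e) y.
  move=> m1; rewrite /mchar_pow etaE; have [->|y0] := eqVneq y 0.
    by rewrite !(cf_zero chF) expr0n; case: m m1.
  by rewrite (ch_mulr chF).
pose f (l : F) := \sum_y ch (7 * e) y * ch (11 * e) (1 - y) * ch e (1 - l * y).
pose J := jacobi (ch (7 * e)) (ch (11 * e)).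
have mulE (y : F) : mchar_mul (mchar_conj (mchar_pow eta 7)) (mchar_pow eta 18) y = ch (11 * e) y.
  rewrite /mchar_mul /mchar_conj !powE // (ch_conj chF) -(cf_D chF).
  by congr (ch _ y); ring.
have hypE (l : F) : hyp21 (mchar_conj eta) (mchar_pow eta 7) (mchar_pow eta 18) l = f l / J.
  rewrite /hyp21 /period21 /jacobi; congr (_ / _); apply: eq_bigr => y _.
    by rewrite mulE powE // /mchar_conj conjCK etaE.
  by rewrite mulE powE.
have J0 : J != 0 := jacobi_neq0 chF psiD psi0 psi1 e24 e12.
have u0 : 1 - 4 * x != 0.
  apply: contra_neq hx2 => u0; apply: (mulfI f0); rewrite divff //.
  by apply/eqP; rewrite eq_sym -subr_eq0 u0.
have v0 : 1 + 8 * x != 0.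
  apply: contra_neq hx1 => v0; apply: (mulfI eight0); rewrite mulrN divff //.
  by apply/eqP; rewrite -addr_eq0 addrC v0.
(* At [x = 0] the argument is 0, out of reach of Mellin inversion. The left side is 1 there by
   definition, and the two terms on the right are 1 and 0. *)
rewrite /= hypE; have [x0|x0] := eqVneq x 0.
  have -> : f (- 27 * x / (1 - 4 * x) ^+ 3) = J.
    apply: eq_bigr => y _; rewrite x0 mulr0 !mul0r subr0 (ch1 chF) mulr1 //.
  rewrite divff // x0; split=> [s|/(_ 1)]; last by rewrite subr0 expr1n eqxx.
  rewrite subr0 mulr0 subr0 mulr1 /qchar oner_eq0 ifT; last first.
    by apply/existsP; exists 1; rewrite mulr1.
  have -> : (1 + 1) / 2 = 1 :> algC by field.
  have one : (1 + 1) ^+ 2 / 4 = 1 :> F by field.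
  move=> /eqP; rewrite sqrf_eq1 mul1r !powE // => /orP[] /eqP ->.
    by rewrite one subrr expr0n mul0r (ch1 chF) (cf_zero chF) addr0.
  by rewrite opprK one subrr expr0n mul0r (ch1 chF) (cf_zero chF) add0r.
have P := period_pullback chF psiD psi0 psi1 e24 e12 e8 two0 three0 x0 u0 v0.
rewrite -/f -/J in P.
set Gam := \sum_(U | _ == 4 * x) _ in P.
have -> : f (- 27 * x / (1 - 4 * x) ^+ 3) / J = ch (- (3 * e)) (1 - 4 * x) * Gam.
  apply: (mulfI (ch_neq0 chF (3 * e) u0)).
  by rewrite !mulrA P (chVK chF) // mul1r mulrAC divff // mul1r.
(* The roots [U] correspond to the square roots [2 * U - 1] of [1 - x], so there are none when
   [1 - x] is not a square. *)
have rootE (U : F) : (16 * U * (1 - U) == 4 * x) = ((2 * U - 1) ^+ 2 == 1 - x).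
  rewrite -subr_eq0 -[RHS]subr_eq0.
  have -> : 16 * U * (1 - U) - 4 * x = - 4 * ((2 * U - 1) ^+ 2 - (1 - x)) by ring.
  by rewrite mulf_eq0 oppr_eq0 (negPf f0).
split=> [s sE|no]; last first.
  by rewrite /Gam big_pred0 ?mulr0 // => U; rewrite rootE; apply/negbTE/no.
have valE (t : F) : ch (3 * e) ((1 + t) ^+ 2 / (4 * (1 - 4 * x))) =
  ch (- (3 * e)) (1 - 4 * x) * ch (6 * e) ((1 + t) / 2).
  have -> : (1 + t) ^+ 2 / (4 * (1 - 4 * x)) = (1 - 4 * x)^-1 * ((1 + t) / 2) ^+ 2.
    by field; rewrite ?u0 ?two0 ?f0.
  rewrite [LHS](cf_M chF) (chV chF) -(ch_mul2 chF); congr (_ * ch _ _); ring.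
rewrite !powE // -[1 - s]/(1 + - s) !valE -mulrDr mulrCA; congr (_ * _).
have U1 (U : F) : (16 * U * (1 - U) == 4 * x) = (U == (1 + s) / 2) || (U == (1 + - s) / 2).
  rewrite rootE -sE eqf_sqr -!(inj_eq (mulfI two0) U).
  have hE (t : F) : 2 * ((1 + t) / 2) = t + 1 by field.
  by rewrite !hE !subr_eq.
(* For [s = 0] the two roots coincide and count once in [Gam]; on the right [qchar 0 = 0] halves the
   doubled term. *)
rewrite /Gam; have [s0|s0] := eqVneq s 0.
  have x1 : 1 - x = 0 by rewrite -sE s0 expr0n.
  rewrite /qchar x1 eqxx addr0 s0 oppr0 (big_pred1 ((1 + 0) / 2)) => [|U]; last first.
    by rewrite U1 s0 oppr0 orbb.
  by field.
rewrite /qchar -sE expf_eq0 (negPf s0) /= ifT; last by apply/existsP; exists s; rewrite expr2.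
have -> : (1 + 1) / 2 = 1 :> algC by field.
rewrite mul1r (eq_bigl (mem [set (1 + s) / 2; (1 + - s) / 2])) => [|U]; last first.
  by rewrite U1 !inE.
rewrite big_setU1 ?big_set1 // inE; apply: contraNneq s0 => ss.
apply/eqP/(mulfI two0); rewrite mulr0.
have -> : 2 * s = 2 * ((1 + s) / 2 - (1 + - s) / 2) by field.
by rewrite ss subrr mulr0.
Qed.
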